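(* Let $m,n\ge 2$ and $1\le p\le\infty$. For all $A_1,\dots,A_m\in\mathbb{M}_n$, $$\Bigl\| \sum_{k=1}^m A_k \Bigr\|_p\ \le\ \Bigl\| \sum_{k=1}^m |A_k|_{\mathrm{qsym}} \Bigr\|_p\qquad\text{if } 1\le p\le 2,$$ $$\Bigl\| \sum_{k=1}^m A_k \Bigr\|_p\ \le\ 2^{\frac12-\frac1p}\,\Bigl\| \sum_{k=1}^m |A_k|_{\mathrm{qsym}} \Bigr\|_p\qquad\text{if } 2\le p\le \infty.$$ Moreover, the constants $1$ (for $1\le p\le 2$) and $2^{\frac12-\frac1p}$ (for $2\le p\le\infty$) are sharp: if $c$ is a real number such that $\|\sum_{k=1}^m A_k\|_p\le c\,\|\sum_{k=1}^m|A_k|_{\mathrm{qsym}}\|_p$ for all $A_1,\dots,A_m\in\mathbb{M}_n$, then $c\ge 1$ when $1\le p\le 2$, and $c\ge 2^{\frac12-\frac1p}$ when $2\le p\le\infty$.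
   Context: $\mathbb{M}_n$ is the set of $n\times n$ complex matrices, $Z^*$ is the conjugate transpose of $Z$, $|Z|:=(Z^*Z)^{1/2}$, and the quadratic symmetric modulus is $|Z|_{\mathrm{qsym}}:=\left(\frac{|Z|^2+|Z^*|^2}{2}\right)^{1/2}$. For $1\le p<\infty$, the Schatten $p$-norm is $\|X\|_p:=(\operatorname{Tr}|X|^p)^{1/p}$; $\|X\|_\infty$ is the operator norm (largest singular value), and $\frac1\infty=0$. *)

(* Defs.v *)
From HB Require Import structures.
From mathcomp Require Import all_boot all_order all_algebra.
From mathcomp Require Import complex.
From mathcomp Require Import reals constructive_ereal exp.

Set Implicit Arguments.
Unset Strict Implicit.
Unset Printing Implicit Defensive.

Import Order.TTheory GRing.Theory Num.Theory.
Local Open Scope ring_scope.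
Local Open Scope sesquilinear_scope.
Local Open Scope complex_scope.

Section SymmetricModulus.
Context {R : realType} {n : nat}.
Implicit Types (A X Z : 'M[R[i]]_n).

(* Functional calculus on Hermitian matrices: f acts on the (real) eigenvalues
   in the unitary diagonalization A = P^-1 *m diag_mx D *m P. *)
Definition hermfun (f : R -> R) A : 'M[R[i]]_n :=
  invmx (spectralmx A)
    *m diag_mx (map_mx (fun z => (f (complex.Re z))%:C) (spectral_diag A))
    *m spectralmx A.

Definition mxsqrt A : 'M[R[i]]_n := hermfun Num.sqrt A.

Definition mxmod Z : 'M[R[i]]_n := mxsqrt (Z^t* *m Z).

Definition qsymmod Z : 'M[R[i]]_n :=
  mxsqrt (2^-1 *: (mxmod Z *m mxmod Z + mxmod (Z^t*) *m mxmod (Z^t*))).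

(* Operator norm as the largest singular value, i.e. eigenvalue of |X|. *)
Definition opnorm X : R :=
  \big[Num.max/0]_(i < n) complex.Re (spectral_diag (mxmod X) 0 i).

(* Meant for 1 <= p; the value at -oo is a dummy. *)
Definition schatten (p : \bar R) X : R :=
  match p with
  | r%:E => (complex.Re (\tr (hermfun (fun x => x `^ r) (mxmod X)))) `^ r^-1
  | +oo%E => opnorm X
  | -oo%E => 0
  end.

End SymmetricModulus.

(* Main.v *)
Require Import Defs.
From HB Require Import structures.
From mathcomp Require Import all_boot all_order all_algebra.
From mathcomp Require Import complex.
From mathcomp Require Import reals constructive_ereal exp.
From mathcomp Require Import ring lra.
Import Order.TTheory GRing.Theory Num.Theory.
Local Open Scope ring_scope.

(** The proof compares traces of p-th powers. Write A' for the adjoint of A,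
    S for the sum of the A_k, a and b for the sums of the moduli |A_k| and
    |A_k'|, Q for the sum of the quadratic symmetric moduli Q_k of the A_k, and
    q = sqrt 2 * Q.

    The Hermitian dilation of A_k, with zero diagonal blocks and off-diagonal
    blocks A_k and A_k', lies between the opposite and the positive copy of its
    modulus, which is block diagonal with blocks |A_k'| and |A_k|. Summing over
    k and applying Jensen's inequality in the eigenbasis of the dilation of S
    gives 2 tr |S|^p <= tr a^p + tr b^p ([trpow_sum_le_moduli]).

    Since |A_k|^2 + |A_k'|^2 = 2 Q_k^2, an inequality of Lieb's type shows that
    tr (a K a K') + tr (b K b K') <= tr (q K q K') for every matrix K
    ([superop_le], [moduli_superop_le]). For K = q^((p - 2) / 2) the right side
    is tr q^p. Restricting the left side to diagonal entries in the eigenbases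
    of a and b, and using Jensen's inequality for negative powers, one gets
    tr a^p + tr b^p <= tr q^p for p >= 2 ([trpow_superadd]) and
    tr a^p + tr b^p <= 2^(1 - p/2) tr q^p for 1 <= p <= 2 ([trpow_concave]).
    As tr q^p = 2^(p/2) tr Q^p, these are the two bounds for finite p. For p
    infinite, taking K of rank one yields a <= q and b <= q, hence a bound of
    the dilation of S by sqrt 2 times the operator norm of Q.

    The identity matrix, and a matrix unit off the diagonal, show that the
    constants cannot be improved ([sharp_constants]). *)

Set Implicit Arguments.
Unset Strict Implicit.
Unset Printing Implicit Defensive.

(** * Convexity of real powers *)

Section Scalar.
Context {R : realType}.
Implicit Types x y s t c p d : R.

(** From exp u >= 1 + u with u = s ln x, and ln x <= x - 1 where s <= 0
    reverses the sign. *)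
Lemma bernoulli_npos x s : 0 < x -> s <= 0 -> 1 + s * (x - 1) <= x `^ s.
Proof.
move=> x0 s0; have hl : ln x <= x - 1.
  by have := @le_ln1Dx R (x - 1); rewrite [1 + _]addrC subrK; apply; lra.
rewrite /powR gt_eqF//; apply: le_trans (expR_ge1Dx _).
by rewrite lerD2l ler_wnM2l.
Qed.

(** Reduces to the nonpositive exponent 1 - s at x^-1, because x^s = x
    (x^-1)^(1 - s). *)
Lemma bernoulli_ge1 x s : 0 < x -> 1 <= s -> 1 + s * (x - 1) <= x `^ s.
Proof.
move=> x0 s1.
have h : 1 + (1 - s) * (x^-1 - 1) <= x^-1 `^ (1 - s).
  by apply: bernoulli_npos; [rewrite invr_gt0|lra].
rewrite -[X in _ <= _ `^ X](subrK 1) powRD; last by apply/implyP=> _; rewrite gt_eqF.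
rewrite powRr1 ?(ltW x0)//.
have -> : x `^ (s - 1) = x^-1 `^ (1 - s).
  by rewrite -(powR_inv1 (ltW x0)) -powRrM; congr powR; lra.
apply: le_trans (ler_wpM2r (ltW x0) h).
rewrite le_eqVlt; apply/orP; left; apply/eqP.
by field; rewrite gt_eqF.
Qed.

(** The exponents s for which x^s is convex on the positive half-line. *)
Definition convex_exponent s := (1 <= s) || (s <= 0).

(** Bernoulli's inequality for t / c, rescaled: a convex power lies above its
    tangent at c. *)
Lemma powR_tangent s c t : convex_exponent s -> 0 < c -> 0 < t ->
  c `^ s + s * c `^ (s - 1) * (t - c) <= t `^ s.
Proof.
move=> hs c0 t0.
have tc : 0 < t / c by rewrite divr_gt0.
have h : 1 + s * (t / c - 1) <= (t / c) `^ s.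
  by case/orP: hs => ?; [exact: bernoulli_ge1|exact: bernoulli_npos].
have := ler_wpM2l (powR_ge0 c s) h.
rewrite -powRM ?(ltW c0) ?(ltW tc)// (mulrC c) divfK ?gt_eqF//; apply: le_trans.
rewrite powRB; last by apply/implyP=> _; rewrite gt_eqF.
rewrite powRr1 ?(ltW c0)//.
rewrite le_eqVlt; apply/orP; left; apply/eqP.
by field; rewrite gt_eqF.
Qed.

Lemma powR_tangent_ge1 s c t : 1 <= s -> 0 < c -> 0 <= t ->
  c `^ s + s * c `^ (s - 1) * (t - c) <= t `^ s.
Proof.
move=> s1 c0; rewrite le_eqVlt => /predU1P[<-|t0]; last first.
  by apply: powR_tangent => //; rewrite /convex_exponent s1.
rewrite powR0; last by rewrite gt_eqF// (lt_le_trans ltr01).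
rewrite sub0r -[X in X + _](@mulr_powRB1 _ c s) ?(ltW c0) ?(lt_le_trans ltr01)//.
rewrite [X in X <= _](_ : _ = - (c `^ (s - 1) * c * (s - 1))); last by ring.
by rewrite oppr_le0 !mulr_ge0 ?powR_ge0 ?(ltW c0)// subr_ge0.
Qed.

(** The tangent at the barycenter c, averaged against the weights, has
    vanishing linear part. For s <= 0 the points must avoid the pole 0. *)
Lemma powR_jensen (I : finType) (w l : I -> R) s :
  (forall i, 0 <= w i) -> \sum_i w i = 1 -> convex_exponent s ->
  (forall i, 0 <= l i) -> (forall i, s <= 0 -> 0 < l i) ->
  (\sum_i w i * l i) `^ s <= \sum_i w i * l i `^ s.
Proof.
move=> w0 w1 hs l0 lp; set c := \sum_i _.
have c_ge0 : 0 <= c by apply: sumr_ge0 => i _; rewrite mulr_ge0.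
have [c0|] := ltrP 0 c; last first.
  move=> cle; have c0 : c = 0 by apply/eqP; rewrite eq_le cle.
  have wl i : w i * l i = 0.
    apply/eqP; move: c0 => /eqP; rewrite psumr_eq0; last by move=> j _; rewrite mulr_ge0.
    by move=> /allP/(_ i); rewrite mem_index_enum => /(_ isT).
  have s1 : 0 < s.
    case/orP: hs => hs; first exact: lt_le_trans hs.
    have : \sum_i w i = 0; last by rewrite w1 => /eqP; rewrite oner_eq0.
    apply: big1 => i _; move/eqP: (wl i); rewrite mulf_eq0 (gt_eqF (lp i hs)) orbF.
    by move/eqP.
  by rewrite c0 powR0 ?gt_eqF// sumr_ge0// => i _; rewrite mulr_ge0// powR_ge0.
have tg i : c `^ s + s * c `^ (s - 1) * (l i - c) <= l i `^ s.
  case/orP: (hs) => s1; first exact: powR_tangent_ge1.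
  by apply: powR_tangent => //; exact: lp.
apply: (@le_trans _ _ (\sum_i w i * (c `^ s + s * c `^ (s - 1) * (l i - c)))); last first.
  by apply: ler_sum => i _; rewrite ler_wpM2l.
rewrite le_eqVlt; apply/orP; left; apply/eqP.
transitivity ((c `^ s - s * c `^ (s - 1) * c) * (\sum_i w i) +
   s * c `^ (s - 1) * (\sum_i w i * l i)).
  by rewrite w1 -/c; ring.
rewrite [X in X + _]mulr_sumr [X in _ + X]mulr_sumr -big_split; apply: eq_bigr => i _ /=; ring.
Qed.

(** Weighted arithmetic-geometric mean inequality: Bernoulli's inequality with
    exponent s^-1 at (u / v)^s, multiplied by v. *)
Lemma powR_amgm u v s : 0 <= u -> 0 < v -> 0 < s <= 1 ->
  u `^ s * v `^ (1 - s) <= s * u + (1 - s) * v.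
Proof.
move=> u0 v0 /andP[s0 s1].
have [->|un0] := eqVneq u 0.
  by rewrite powR0 ?gt_eqF// mul0r mulr0 add0r mulr_ge0 ?subr_ge0 ?(ltW v0).
have {u0 un0}u0 : 0 < u by rewrite lt_def un0.
have x0 : 0 < (u / v) `^ s by rewrite powR_gt0// divr_gt0.
have := @bernoulli_ge1 _ s^-1 x0; rewrite invf_ge1// => /(_ s1).
rewrite -powRrM mulfV ?gt_eqF// powRr1 ?(ltW (divr_gt0 _ _))// => h.
rewrite powRB; last by apply/implyP=> _; rewrite gt_eqF.
rewrite powRr1 ?(ltW v0)//.
have -> : u `^ s * (v / v `^ s) = (u / v) `^ s * v.
  rewrite powRM ?(ltW u0) ?invr_ge0 ?(ltW v0)// -(powR_inv1 (ltW v0)) -powRrM mulN1r powRN; ring.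
have := ler_wpM2l (ltW (mulr_gt0 s0 v0)) h.
rewrite [X in _ <= X -> _](_ : _ = s * u); last by field; rewrite gt_eqF.
rewrite [X in X <= _ -> _](_ : _ = s * v + (u / v) `^ s * v - v); last by field; rewrite gt_eqF.
lra.
Qed.

Lemma powR_shift_le p x d : 1 <= p -> 0 <= x -> 0 < d <= 1 ->
  (x + d) `^ p <= x `^ p + d * (p * (x + 1) `^ (p - 1)).
Proof.
move=> p1 x0 /andP[d0 d1].
have xd : 0 < x + d by rewrite ltr_wpDl.
have h := powR_tangent_ge1 p1 xd x0.
have h2 : (x + d) `^ (p - 1) <= (x + 1) `^ (p - 1).
  apply: ge0_ler_powR; rewrite ?subr_ge0 ?nnegrE ?lerD2l ?(ltW xd)//.
  by rewrite addr_ge0.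
have := ler_wpM2l (mulr_ge0 (ltW d0) (le_trans ler01 p1)) h2.
by move: h; lra.
Qed.

(** Together with the locally Lipschitz bound [powR_shift_le], this elementary
    fact replaces a continuity argument each time a singular matrix is
    approached by the invertible matrices obtained by adding d to it. *)
Lemma le_of_linear_perturbation (X Y Z : R) :
  (forall d, 0 < d <= 1 -> X <= Y + d * Z) -> X <= Y.
Proof.
move=> h; rewrite leNgt; apply/negP => YX.
(* Half of the gap X - Y is left when d * |Z| <= (X - Y) / 2. *)
pose d := Num.min 1 ((X - Y) / (2 * (`|Z| + 1))).
have Z0 : 0 < 2 * (`|Z| + 1) by rewrite mulr_gt0// ltr_wpDl.
have XY : 0 < X - Y by rewrite subr_gt0.
have d0 : 0 < d by rewrite /d lt_min ltr01 divr_gt0.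
have := h d; rewrite d0 ge_min lexx => /(_ isT); apply/negP; rewrite -ltNge.
have dle : d <= (X - Y) / (2 * (`|Z| + 1)) by rewrite ge_min lexx orbT.
have : d * Z <= (X - Y) / 2.
  apply: (@le_trans _ _ (d * (`|Z| + 1))).
    by rewrite ler_wpM2l ?(ltW d0)// (le_trans (ler_norm _))// lerDl.
  apply: le_trans (ler_wpM2r _ dle) _; first by rewrite addr_ge0.
  rewrite le_eqVlt; apply/orP; left; apply/eqP; field.
  by rewrite gt_eqF// ltr_wpDl.
lra.
Qed.

Lemma sum_powR_shift_limit (I : finType) (l : I -> R) p c X :
  1 <= p -> 0 <= c -> (forall i, 0 <= l i) ->
  (forall d, 0 < d -> X <= \sum_i (c * (l i + d)) `^ p) ->
  X <= \sum_i (c * l i) `^ p.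
Proof.
move=> p1 c0 l0 h.
apply: (@le_of_linear_perturbation _ _ (\sum_i c `^ p * (p * (l i + 1) `^ (p - 1)))) => d d01.
have /andP[d0 _] := d01; apply: le_trans (h d d0) _.
rewrite mulr_sumr -big_split; apply: ler_sum => i _ /=.
rewrite !powRM ?addr_ge0 ?(ltW d0)// mulrCA -mulrDr ler_wpM2l ?powR_ge0//.
exact: powR_shift_le.
Qed.

End Scalar.

(** * Real parts over an abstract complexification *)

(** The matrix theory below sees R[i] only through these properties of the
    embedding of R and of the real part; the coordinates of complex numbers
    never enter. *)
Record realPart (R : realType) (C : numClosedFieldType) := RealPart {
  rp_embed : {rmorphism R -> C};
  rp_re : C -> R;
  reD : forall x y, rp_re (x + y) = rp_re x + rp_re y;
  reZ : forall k x, rp_re (rp_embed k * x) = k * rp_re x;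
  re1 : rp_re 1 = 1;
  re_conj : forall x, rp_re (x^*) = rp_re x;
  conj_rc : forall k, (rp_embed k)^* = rp_embed k;
  rc_re : forall x, x \is Num.real -> rp_embed (rp_re x) = x;
  re_ge0 : forall x, 0 <= x -> 0 <= rp_re x;
  sqr_re : forall x, rp_re x ^+ 2 <= rp_re (x * x^*) }.

Section ComplexMatrices.
Local Open Scope sesquilinear_scope.
Context {R : realType} {C : numClosedFieldType} (S : realPart R C).
Local Notation rc := (rp_embed S).
Local Notation re := (rp_re S).
Local Notation "k %:C" := (rc k).

Lemma rcK k : re k%:C = k.
Proof. by rewrite -[rc k]mulr1 reZ re1 mulr1. Qed.

Lemma re0 : re 0 = 0.
Proof. by rewrite -(rmorph0 rc) rcK. Qed.

Lemma reN x : re (- x) = - re x.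
Proof. by rewrite -mulN1r -(rmorphN1 rc) reZ mulN1r. Qed.

Lemma reB x y : re (x - y) = re x - re y.
Proof. by rewrite reD reN. Qed.

Lemma re_sum (I : finType) (F : I -> C) :
  re (\sum_i F i) = \sum_i re (F i).
Proof. exact: (big_morph _ (reD S) re0). Qed.

Definition sqmod x : R := re (x * x^*).

Lemma sqmod_ge0 x : 0 <= sqmod x.
Proof. by rewrite re_ge0// mul_conjC_ge0. Qed.

Lemma sqmodE x : (sqmod x)%:C = x * x^*.
Proof. by rewrite rc_re// ger0_real// mul_conjC_ge0. Qed.

Lemma sqmod_eq0 x : (sqmod x == 0) = (x == 0).
Proof. by rewrite -(fmorph_eq0 rc) sqmodE mul_conjC_eq0. Qed.

(** * Adjoints and unitary diagonalization *)

Lemma trmxCM m n p (A : 'M[C]_(m, n)) (B : 'M[C]_(n, p)) :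
  (A *m B)^t* = B^t* *m A^t*.
Proof. by rewrite trmx_mul map_mxM. Qed.

Lemma trmxCD m n (A B : 'M[C]_(m, n)) : (A + B)^t* = A^t* + B^t*.
Proof. by rewrite linearD map_mxD. Qed.

Lemma trmxCZ m n (k : R) (A : 'M[C]_(m, n)) : (k%:C *: A)^t* = k%:C *: A^t*.
Proof. by apply/matrixP=> i j; rewrite !mxE rmorphM /= conj_rc. Qed.

Lemma trmxC_sum (I : finType) m n (F : I -> 'M[C]_(m, n)) :
  (\sum_i F i)^t* = \sum_i (F i)^t*.
Proof. by rewrite !raddf_sum. Qed.

Lemma trmxC1 n : (1%:M : 'M[C]_n)^t* = 1%:M.
Proof. by rewrite trmx1 map_mx1. Qed.

Lemma re_mxtraceC n (A : 'M[C]_n) : re (\tr (A^t*)) = re (\tr A).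
Proof.
by rewrite /mxtrace !re_sum; apply: eq_bigr => i _; rewrite !mxE re_conj.
Qed.

Lemma unitaryVmx n (U : 'M[C]_n) : U \is unitarymx -> U^t* *m U = 1%:M.
Proof. by move=> hU; rewrite -invmx_unitary// mulVmx// unitarymx_unit. Qed.

Lemma unitarymxV n (U : 'M[C]_n) : U \is unitarymx -> U *m U^t* = 1%:M.
Proof. by move/unitarymxP. Qed.

Definition herm n (A : 'M[C]_n) := A^t* = A.

Lemma hermP n (A : 'M[C]_n) : herm A -> A \is hermsymmx.
Proof. by move=> hA; apply/is_hermitianmxP; rewrite expr0 scale1r hA. Qed.

(** Hermitian matrices are handled through an arbitrary unitary diagonalization
    instead of the chosen one [spectralmx]; the rows of U are the
    eigenvectors. [hfunE] shows that the functional calculus does not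
    depend on the choice. *)
Definition hdiag n (U : 'M[C]_n) (l : 'I_n -> R) : 'M[C]_n :=
  U^t* *m diag_mx (\row_i (l i)%:C) *m U.

Lemma trmxC_diag n (l : 'I_n -> R) :
  (diag_mx (\row_i (l i)%:C))^t* = diag_mx (\row_i (l i)%:C) :> 'M[C]_n.
Proof.
rewrite tr_diag_mx map_diag_mx; congr diag_mx.
by apply/rowP => i; rewrite !mxE; exact: conj_rc.
Qed.

Lemma hdiag_herm n U (l : 'I_n -> R) : herm (hdiag U l).
Proof. by rewrite /herm /hdiag !trmxCM trmxCK trmxC_diag mulmxA. Qed.

Lemma spectral_hdiag n (A : 'M[C]_n) : herm A ->
  A = hdiag (spectralmx A) (fun i => re (spectral_diag A 0 i)).
Proof.
move=> /hermP hA; have /hermitian_normalmx/orthomx_spectralP {1}-> := hA.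
rewrite /hdiag invmx_unitary ?spectral_unitarymx//.
congr (_ *m diag_mx _ *m _); apply/rowP=> i; rewrite !mxE.
by rewrite rc_re//; have /mxOverP := hermitian_spectral_diag_real hA; apply.
Qed.

Lemma herm_hdiag n (A : 'M[C]_n) : herm A ->
  exists U l, U \is unitarymx /\ A = hdiag U l.
Proof.
by move=> /spectral_hdiag hA; do 2!eexists; split; [exact: spectral_unitarymx|exact: hA].
Qed.

Definition hfun n (f : R -> R) (A : 'M[C]_n) : 'M[C]_n :=
  hdiag (spectralmx A) (fun i => f (re (spectral_diag A 0 i))).

Lemma hfun_herm n f (A : 'M[C]_n) : herm (hfun f A).
Proof. by rewrite /hfun; apply: hdiag_herm. Qed.

(** In the eigenbases the hypothesis says k i * W i j = W i j * l j, so that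
    W i j = 0 or k i = l j, and both cases survive the application of f.
    Three facts are instances of this lemma: the functional calculus does not
    depend on the diagonalization (T = 1), it respects diagonal blocks (T an
    inclusion of a block), and it exchanges the Gram matrices A A' and A' A of
    a matrix and its adjoint A' (T = A). *)
Lemma hdiag_intertwine m n (U : 'M[C]_m) (V : 'M[C]_n) k l f (T : 'M[C]_(m, n)) :
  U \is unitarymx -> V \is unitarymx ->
  hdiag U k *m T = T *m hdiag V l ->
  hdiag U (f \o k) *m T = T *m hdiag V (f \o l).
Proof.
move=> hU hV h; pose W := U *m T *m V^t*.
have e g : hdiag U (g \o k) *m T =
    U^t* *m (diag_mx (\row_i (g (k i))%:C) *m W) *m V.
  by rewrite /hdiag /W !mulmxA -[RHS]mulmxA unitaryVmx// mulmx1.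
have e' g : T *m hdiag V (g \o l) =
    U^t* *m (W *m diag_mx (\row_i (g (l i))%:C)) *m V.
  by rewrite /hdiag /W !mulmxA unitaryVmx// mul1mx.
have {}h : diag_mx (\row_i (k i)%:C) *m W = W *m diag_mx (\row_i (l i)%:C).
  have : hdiag U (id \o k) *m T = T *m hdiag V (id \o l) by exact: h.
  rewrite e e' => /(congr1 (fun X => U *m X *m V^t*)).
  by rewrite !mulmxA unitarymxV// !mul1mx -!mulmxA unitarymxV// !mulmx1.
rewrite e e'; congr (_ *m _ *m _); move: W h {e e'} => W h.
apply/matrixP => i j.
move/matrixP/(_ i j): h; rewrite !mul_diag_mx !mul_mx_diag !mxE => h.
have [->|W0] := eqVneq (W i j) 0; first by rewrite mulr0 mul0r.
by move: h; rewrite [RHS]mulrC => /(mulIf W0)/(fmorph_inj rc) ->; rewrite mulrC.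
Qed.

Lemma hfun_intertwine m n f (A : 'M[C]_m) (B : 'M[C]_n) (T : 'M[C]_(m, n)) :
  herm A -> herm B -> A *m T = T *m B ->
  hfun f A *m T = T *m hfun f B.
Proof.
move=> /spectral_hdiag hA /spectral_hdiag hB h; rewrite /hfun.
by apply: hdiag_intertwine (spectral_unitarymx _) (spectral_unitarymx _) _;
  rewrite -hA -hB.
Qed.

Lemma hfunE n f (U : 'M[C]_n) l : U \is unitarymx ->
  hfun f (hdiag U l) = hdiag U (f \o l).
Proof.
move=> hU; have := @hdiag_intertwine n n U (spectralmx (hdiag U l)) l
  (fun i => re (spectral_diag (hdiag U l) 0 i)) f 1%:M hU
  (spectral_unitarymx _).
rewrite -(spectral_hdiag (hdiag_herm U l)) !mulmx1 !mul1mx => /(_ erefl) ->.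
by rewrite /hfun.
Qed.

Local Notation trpow p A := (re (\tr (hfun (fun x => x `^ p) A))).

Lemma eq_hdiag n (U : 'M[C]_n) k l : k =1 l -> hdiag U k = hdiag U l.
Proof.
move=> e; rewrite /hdiag; congr (_ *m diag_mx _ *m _).
by apply/rowP=> i; rewrite !mxE e.
Qed.

Lemma hdiagM n (U : 'M[C]_n) k l : U \is unitarymx ->
  hdiag U k *m hdiag U l = hdiag U (fun i => k i * l i).
Proof.
move=> hU; rewrite /hdiag !mulmxA; congr (_ *m _).
rewrite -[X in X *m _]mulmxA unitarymxV// mulmx1 -mulmxA; congr (_ *m _).
rewrite mulmx_diag; congr diag_mx.
by apply/rowP=> i; rewrite !mxE rmorphM.
Qed.

Lemma hdiagD n (U : 'M[C]_n) k l :
  hdiag U k + hdiag U l = hdiag U (fun i => k i + l i).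
Proof.
rewrite /hdiag -mulmxDl -mulmxDr -linearD; congr (_ *m diag_mx _ *m _).
by apply/rowP=> i; rewrite !mxE rmorphD.
Qed.

Lemma hdiagZ n (U : 'M[C]_n) c l :
  c%:C *: hdiag U l = hdiag U (fun i => c * l i).
Proof.
rewrite /hdiag scalemxAl scalemxAr -linearZ /=; congr (_ *m diag_mx _ *m _).
by apply/rowP=> i; rewrite !mxE rmorphM.
Qed.

Lemma hdiag_cst n (U : 'M[C]_n) c : U \is unitarymx ->
  hdiag U (fun=> c) = (c%:C)%:M.
Proof.
move=> hU; rewrite /hdiag (_ : diag_mx _ = (c%:C)%:M); last first.
  by apply/matrixP => i j; rewrite !mxE.
by rewrite -mulmxA mul_scalar_mx -scalemxAr unitaryVmx// scalemx1.
Qed.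

Lemma tr_hdiag n (U : 'M[C]_n) l : U \is unitarymx ->
  re (\tr (hdiag U l)) = \sum_i l i.
Proof.
move=> hU; rewrite /hdiag mxtrace_mulC mulmxA unitarymxV// mul1mx mxtrace_diag.
by rewrite re_sum; apply: eq_bigr => i _; rewrite !mxE rcK.
Qed.

(** * Quadratic forms and positive semidefinite matrices *)

Definition qf n (A : 'M[C]_n) (v : 'rV[C]_n) : R :=
  re ((v *m A *m v^t*) 0 0).

Lemma qfD n (A B : 'M[C]_n) v : qf (A + B) v = qf A v + qf B v.
Proof. by rewrite /qf mulmxDr mulmxDl mxE reD. Qed.

Lemma qf0 n v : qf (0 : 'M[C]_n) v = 0.
Proof. by rewrite /qf mulmx0 mul0mx mxE re0. Qed.

Lemma qf_sum n (I : finType) (F : I -> 'M[C]_n) v :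
  qf (\sum_i F i) v = \sum_i qf (F i) v.
Proof. exact: (big_morph (fun A => qf A v) (fun A B => qfD A B v) (qf0 v)). Qed.

Lemma qfZ n c (A : 'M[C]_n) v : qf (c%:C *: A) v = c * qf A v.
Proof. by rewrite /qf -scalemxAr -scalemxAl mxE reZ. Qed.

Lemma qf_row m n (U : 'M[C]_(m, n)) A i :
  qf A (row i U) = re ((U *m A *m U^t*) i i).
Proof.
rewrite /qf -row_mul; congr (re _).
rewrite !mxE; apply: eq_bigr => j _; by rewrite !mxE.
Qed.

Lemma sum_qf_row m n (U : 'M[C]_(m, n)) A :
  \sum_i qf A (row i U) = re (\tr (U *m A *m U^t*)).
Proof. by rewrite re_sum; apply: eq_bigr => i _; rewrite qf_row. Qed.

Lemma sum_qf_unitary n (U : 'M[C]_n) A : U \is unitarymx ->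
  \sum_i qf A (row i U) = re (\tr A).
Proof. by move=> hU; rewrite sum_qf_row mxtrace_mulC mulmxA unitaryVmx// mul1mx. Qed.

Lemma qf_diag n (l : 'I_n -> R) v :
  qf (diag_mx (\row_i (l i)%:C)) v = \sum_i l i * sqmod (v 0 i).
Proof.
rewrite /qf mul_mx_diag mxE re_sum; apply: eq_bigr => i _; rewrite !mxE.
by rewrite mulrAC -sqmodE mulrC reZ rcK.
Qed.

Lemma qf_congr m n (A : 'M[C]_n) (T : 'M[C]_(m, n)) v :
  qf A (v *m T) = qf (T *m A *m T^t*) v.
Proof. by rewrite /qf trmxCM !mulmxA. Qed.

Lemma qf_hdiag n (U : 'M[C]_n) l v :
  qf (hdiag U l) v = \sum_i l i * sqmod ((v *m U^t*) 0 i).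
Proof. by rewrite -qf_diag qf_congr trmxCK. Qed.

Lemma qf_hdiag_row n (U : 'M[C]_n) l i : U \is unitarymx ->
  qf (hdiag U l) (row i U) = l i.
Proof.
move=> hU; rewrite qf_row /hdiag !mulmxA unitarymxV// mul1mx -mulmxA unitarymxV//.
by rewrite mulmx1 !mxE eqxx mulr1n rcK.
Qed.

Definition psd n (A : 'M[C]_n) := herm A /\ forall v, 0 <= qf A v.

Lemma psd_hdiag n (A : 'M[C]_n) : psd A ->
  exists U l, [/\ U \is unitarymx, A = hdiag U l & forall i, 0 <= l i].
Proof.
move=> [/herm_hdiag[U [l [hU ->]]] h]; exists U, l; split=> // i.
by rewrite -(qf_hdiag_row l i hU).
Qed.

Lemma hdiag_psd n (U : 'M[C]_n) l : (forall i, 0 <= l i) -> psd (hdiag U l).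
Proof.
move=> l0; split; first exact: hdiag_herm.
by move=> v; rewrite qf_hdiag sumr_ge0// => i _; rewrite mulr_ge0// sqmod_ge0.
Qed.

Lemma hermD n (A B : 'M[C]_n) : herm A -> herm B -> herm (A + B).
Proof. by rewrite /herm trmxCD => -> ->. Qed.

Lemma herm0 n : herm (0 : 'M[C]_n).
Proof. by rewrite /herm linear0 map_mx0. Qed.

Lemma hermZ n c (A : 'M[C]_n) : herm A -> herm (c%:C *: A).
Proof. by rewrite /herm trmxCZ => ->. Qed.

Lemma psdD n (A B : 'M[C]_n) : psd A -> psd B -> psd (A + B).
Proof.
by move=> [hA A0] [hB B0]; split=> [|v]; [exact: hermD|rewrite qfD addr_ge0].
Qed.

Lemma psd0 n : psd (0 : 'M[C]_n).
Proof. by split=> [|v]; [exact: herm0|by rewrite qf0]. Qed.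

Lemma psd_sum n (I : finType) (F : I -> 'M[C]_n) :
  (forall i, psd (F i)) -> psd (\sum_i F i).
Proof. by move=> h; apply: (big_ind (@psd n)) => //; [exact: psd0|exact: psdD]. Qed.

Lemma psdZ n c (A : 'M[C]_n) : 0 <= c -> psd A -> psd (c%:C *: A).
Proof.
by move=> c0 [hA A0]; split=> [|v]; [exact: hermZ|rewrite qfZ mulr_ge0].
Qed.

Lemma gram_psd m n (A : 'M[C]_(m, n)) : psd (A^t* *m A).
Proof.
split=> [|v]; first by rewrite /herm trmxCM trmxCK.
rewrite /qf mulmxA -mulmxA -{2}[A]trmxCK -trmxCM mxE re_sum.
by apply: sumr_ge0 => i _; rewrite !mxE; exact: sqmod_ge0.
Qed.

Lemma hfun_comp n f g (A : 'M[C]_n) : hfun f (hfun g A) = hfun (f \o g) A.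
Proof. by rewrite {2}/hfun hfunE ?spectral_unitarymx. Qed.

Lemma hfun_id n (A : 'M[C]_n) : herm A -> hfun id A = A.
Proof. by move=> /spectral_hdiag {2}->. Qed.

Lemma eq_hfun_psd n f g (A : 'M[C]_n) :
  (forall x, 0 <= x -> f x = g x) -> psd A -> hfun f A = hfun g A.
Proof.
move=> fg /psd_hdiag[U [l [hU -> l0]]]; rewrite !hfunE//.
by apply: eq_hdiag => i; exact: fg.
Qed.

Lemma hfun_psd n f (A : 'M[C]_n) :
  (forall x, 0 <= f x) -> psd (hfun f A).
Proof. by move=> f0; apply: hdiag_psd. Qed.

Lemma hfunM n f g (A : 'M[C]_n) : hfun f A *m hfun g A = hfun (fun x => f x * g x) A.
Proof. by rewrite /hfun hdiagM ?spectral_unitarymx. Qed.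

Lemma sum_sqmod_coord n (U : 'M[C]_n) (v : 'rV[C]_n) : U \is unitarymx ->
  \sum_i sqmod ((v *m U^t*) 0 i) = qf 1%:M v.
Proof.
move=> hU; rewrite -(rmorph1 rc) -(hdiag_cst 1 hU) qf_hdiag.
by apply: eq_bigr => i _; rewrite mul1r.
Qed.

Lemma qf1_row n (U : 'M[C]_n) i : U \is unitarymx -> qf 1%:M (row i U) = 1.
Proof.
move=> hU; rewrite -(rmorph1 rc) -(hdiag_cst 1 hU); exact: qf_hdiag_row.
Qed.

(** The squared moduli of the coordinates of a unit vector in the eigenbasis of
    A are probability weights. *)
Lemma qf_jensen n (A : 'M[C]_n) v s :
  psd A -> (s <= 0 -> A \in unitmx) -> convex_exponent s -> qf 1%:M v = 1 ->
  (qf A v) `^ s <= qf (hfun (fun x => x `^ s) A) v.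
Proof.
move=> /psd_hdiag[U [l [hU -> l0]]] hA hs v1.
rewrite hfunE// !qf_hdiag; under eq_bigr do rewrite mulrC.
under [leRHS]eq_bigr do rewrite mulrC /=.
apply: powR_jensen => //; first by move=> i; exact: sqmod_ge0.
  by rewrite sum_sqmod_coord.
move=> i /hA; rewrite /hdiag !unitmx_mul => /andP[/andP[_]].
rewrite unitmxE det_diag unitfE prodf_seq_neq0 => /allP/(_ i).
rewrite mem_index_enum => /(_ isT) /=; rewrite mxE fmorph_eq0 => li _.
by rewrite lt_def li l0.
Qed.

(** Sum over the eigenvectors u of H: the p-th power of |qf H u| is at
    most qf G u to the p, and Jensen's inequality bounds this by the
    diagonal entry of G^p at u. *)
Lemma trpow_norm_le n (H G : 'M[C]_n) p : 1 <= p ->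
  herm H -> psd G -> (forall v, `|qf H v| <= qf G v) ->
  re (\tr (hfun (fun x => `|x| `^ p) H)) <= trpow p G.
Proof.
move=> p1 /herm_hdiag[U [l [hU ->]]] hG HG.
rewrite hfunE// tr_hdiag// -(sum_qf_unitary _ hU); apply: ler_sum => i _ /=.
have := HG (row i U); rewrite qf_hdiag_row// => h.
apply: (@le_trans _ _ (qf G (row i U) `^ p)).
  by apply: ge0_ler_powR; rewrite ?nnegrE ?(le_trans _ p1)//; case: hG.
apply: qf_jensen => //; rewrite ?qf1_row//; last by rewrite /convex_exponent p1.
by move=> p0; have := le_trans p1 p0; rewrite ler10.
Qed.

(** * The modulus and the Hermitian dilation *)

Definition hmod n (Z : 'M[C]_n) := hfun Num.sqrt (Z^t* *m Z).

Lemma hmod_psd n (Z : 'M[C]_n) : psd (hmod Z).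
Proof. by apply: hfun_psd => x; exact: sqrtr_ge0. Qed.

Lemma hmod_sqr n (Z : 'M[C]_n) : hmod Z *m hmod Z = Z^t* *m Z.
Proof.
rewrite /hmod hfunM -[RHS]hfun_id; last by case: (gram_psd Z).
apply: eq_hfun_psd; last exact: gram_psd.
by move=> x x0; rewrite -expr2 sqr_sqrtr.
Qed.

Lemma hmod_id n (Z : 'M[C]_n) : psd Z -> hmod Z = Z.
Proof.
move=> hZ; have [hZh _] := hZ.
rewrite /hmod hZh -{1 2}(hfun_id hZh) hfunM hfun_comp -[RHS](hfun_id hZh).
apply: eq_hfun_psd => // x x0 /=.
by rewrite -expr2 sqrtr_sqr ger0_norm.
Qed.

Lemma hmod_herm n (H : 'M[C]_n) : herm H -> hmod H = hfun Num.norm H.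
Proof.
move=> hZh; rewrite /hmod hZh -{1 2}(hfun_id hZh) hfunM hfun_comp.
by apply: eq_hdiag => i /=; rewrite -expr2 sqrtr_sqr.
Qed.

Lemma qf_le_hmod n (H : 'M[C]_n) v : herm H -> `|qf H v| <= qf (hmod H) v.
Proof.
move=> hH; rewrite hmod_herm//; move/herm_hdiag: hH => [U [l [hU ->]]].
rewrite hfunE// !qf_hdiag; apply: le_trans (ler_norm_sum _ _ _) _.
apply: ler_sum => i _; by rewrite normrM ler_wpM2l// ger0_norm// sqmod_ge0.
Qed.

Lemma hfun_block n f (A B : 'M[C]_n) : herm A -> herm B ->
  hfun f (block_mx A 0 0 B) = block_mx (hfun f A) 0 0 (hfun f B).
Proof.
move=> hA hB; have hAB : herm (block_mx A 0 0 B).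
  by rewrite /herm tr_block_mx map_block_mx hA hB !linear0 !map_mx0.
have h1 : hfun f (block_mx A 0 0 B) *m col_mx 1%:M 0 = col_mx 1%:M 0 *m hfun f A.
  apply: hfun_intertwine => //.
  by rewrite mul_block_col !mulmx1 !mul0mx !mulmx0 !addr0 mul_col_mx mul1mx mul0mx.
have h2 : hfun f (block_mx A 0 0 B) *m col_mx 0 1%:M = col_mx 0 1%:M *m hfun f B.
  apply: hfun_intertwine => //.
  by rewrite mul_block_col !mulmx1 !mul0mx !mulmx0 !add0r mul_col_mx mul1mx mul0mx.
rewrite -[LHS]mulmx1 (_ : 1%:M = row_mx (col_mx 1%:M 0) (col_mx 0 1%:M)); last first.
  by rewrite -block_mxEh scalar_mx_block.
by rewrite mul_mx_row h1 h2 !mul_col_mx !mul1mx !mul0mx block_mxEh.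
Qed.

(** The Hermitian dilation turns an arbitrary A into a Hermitian matrix whose
    modulus is block diagonal with blocks |A'| and |A|, where A' is the
    adjoint of A. Inequalities about non-normal matrices then follow from
    Hermitian ones. *)
Definition dilation n (A : 'M[C]_n) : 'M[C]_(n + n) := block_mx 0 A (A^t*) 0.

Lemma dilation_herm n (A : 'M[C]_n) : herm (dilation A).
Proof.
by rewrite /herm tr_block_mx map_block_mx !linear0 !map_mx0 trmxCK.
Qed.

Lemma dilation_sqr n (A : 'M[C]_n) :
  dilation A *m dilation A = block_mx (A *m A^t*) 0 0 (A^t* *m A).
Proof.
by rewrite mulmx_block !mul0mx !mulmx0 !addr0 !add0r.
Qed.

Lemma cogram_herm m n (A : 'M[C]_(m, n)) : herm (A *m A^t*).
Proof. by rewrite /herm trmxCM trmxCK. Qed.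

Lemma gram_herm m n (A : 'M[C]_(m, n)) : herm (A^t* *m A).
Proof. by rewrite /herm trmxCM trmxCK. Qed.

Lemma hmod_dilation n (A : 'M[C]_n) :
  hmod (dilation A) = block_mx (hmod (A^t*)) 0 0 (hmod A).
Proof.
rewrite /hmod dilation_herm dilation_sqr trmxCK hfun_block//.
  exact: cogram_herm.
exact: gram_herm.
Qed.

Lemma dilation_sum n (I : finType) (A : I -> 'M[C]_n) :
  dilation (\sum_i A i) = \sum_i dilation (A i).
Proof.
apply: (big_morph (@dilation n)) => [A1 A2|].
  by rewrite /dilation add_block_mx !addr0 trmxCD.
by rewrite /dilation linear0 map_mx0 block_mx0.
Qed.

Lemma block_sum n (I : finType) (A B : I -> 'M[C]_n) :
  \sum_i block_mx (A i) 0 0 (B i) = block_mx (\sum_i A i) 0 0 (\sum_i B i).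
Proof.
apply/esym; apply: (big_rec3 (fun a b c => block_mx a 0 0 b = c)) => [|i a b c _ <-].
  by rewrite block_mx0.
by rewrite add_block_mx !addr0.
Qed.

Lemma qf_dilation_sum n (I : finType) (A : I -> 'M[C]_n) v :
  `|qf (dilation (\sum_i A i)) v| <=
  qf (block_mx (\sum_i hmod ((A i)^t*)) 0 0 (\sum_i hmod (A i))) v.
Proof.
rewrite dilation_sum -block_sum !qf_sum; apply: le_trans (ler_norm_sum _ _ _) _.
apply: ler_sum => i _; rewrite -hmod_dilation; apply: qf_le_hmod.
exact: dilation_herm.
Qed.

(** Since p > 0, the function x^(p/2) factors as x g(x). Writing the two Gram
    matrices as A' A and A A', the trace of A' A g(A' A) equals that of A
    A' g(A A') by cyclicity and A g(A' A) = g(A A') A. *)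
Lemma tr_hmod_adj n (A : 'M[C]_n) p : 0 < p ->
  trpow p (hmod (A^t*)) =
  trpow p (hmod A).
Proof.
move=> p0; rewrite /hmod !hfun_comp trmxCK.
(* At x = 0 the convention 0^-1 = 0 is harmless, since 0^p = 0. *)
pose g (x : R) := Num.sqrt x `^ p / x.
have e (B : 'M[C]_n) : psd B -> hfun ((fun x => x `^ p) \o Num.sqrt) B = B *m hfun g B.
  move=> hB; rewrite -{2}(hfun_id (proj1 hB)) hfunM; apply: eq_hfun_psd => // x x0 /=.
  rewrite /g; have [->|xn0] := eqVneq x 0; first by rewrite sqrtr0 powR0 ?gt_eqF// mul0r.
  by rewrite mulrC divfK.
rewrite !e; [|exact: gram_psd|by rewrite -{1}[A]trmxCK; exact: gram_psd].
congr (re _); rewrite -!mulmxA [RHS]mxtrace_mulC -mulmxA; congr (\tr (_ *m _)).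
apply/esym/hfun_intertwine; rewrite ?mulmxA//.
  exact: gram_herm.
exact: cogram_herm.
Qed.

(** The dilation of the sum is dominated, with both signs, by the sum of the
    moduli of the dilations, so that [trpow_norm_le] applies; each side is
    block diagonal. *)
Lemma trpow_sum_le_moduli n (I : finType) (A : I -> 'M[C]_n) p : 1 <= p ->
  2 * trpow p (hmod (\sum_i A i)) <=
  trpow p (\sum_i hmod (A i)) +
  trpow p (\sum_i hmod ((A i)^t*)).
Proof.
move=> p1; have p0 : 0 < p by apply: lt_le_trans p1.
have hpsd : psd (block_mx (\sum_i hmod ((A i)^t*)) 0 0 (\sum_i hmod (A i))).
  split=> [|v]; last by apply: le_trans (qf_dilation_sum A v).
  rewrite -block_sum -(eq_bigr _ (fun i _ => hmod_dilation (A i))).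
  by apply: (proj1 (psd_sum _)) => i; exact: hmod_psd.
have := trpow_norm_le p1 (dilation_herm (\sum_i A i)) hpsd (qf_dilation_sum A).
have ha : herm (\sum_i hmod (A i)) by apply: (proj1 (psd_sum _)) => i; exact: hmod_psd.
have hb : herm (\sum_i hmod ((A i)^t*)) by apply: (proj1 (psd_sum _)) => i; exact: hmod_psd.
rewrite hfun_block// mxtrace_block reD addrC => /(le_trans _); apply.
rewrite -[hfun (fun x => `|x| `^ p) _](hfun_comp (fun x => x `^ p)).
rewrite -hmod_herm; last exact: dilation_herm.
rewrite hmod_dilation hfun_block; [|exact: (proj1 (hmod_psd _))..].
by rewrite mxtrace_block reD tr_hmod_adj// mulr2n mulrDl mul1r.
Qed.

(** * A Lieb type inequality for superoperators *)

(** Strict positivity is carried by the diagonalization, which makes the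
    functional calculus available for negative powers. *)
Definition posdef n (A : 'M[C]_n) :=
  exists U l, [/\ U \is unitarymx, A = hdiag U l & forall i, 0 < l i].

Lemma posdef_psd n (A : 'M[C]_n) : posdef A -> psd A.
Proof. by move=> [U [l [_ -> l0]]]; apply: hdiag_psd => i; exact: ltW. Qed.

Lemma posdef_herm n (A : 'M[C]_n) : posdef A -> herm A.
Proof. by move=> /posdef_psd[]. Qed.

Lemma eq_hfun_posdef n f g (A : 'M[C]_n) :
  (forall x, 0 < x -> f x = g x) -> posdef A -> hfun f A = hfun g A.
Proof.
move=> fg [U [l [hU -> l0]]]; rewrite !hfunE//.
by apply: eq_hdiag => i; exact: fg.
Qed.

Lemma hfun_posdef n f (A : 'M[C]_n) :
  (forall x, 0 < x -> 0 < f x) -> posdef A -> posdef (hfun f A).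
Proof.
move=> f0 [U [l [hU -> l0]]]; exists U, (f \o l); split=> //.
  by rewrite hfunE.
by move=> i; exact: f0.
Qed.

Lemma hfun_posdef_mul1 n f g (A : 'M[C]_n) :
  (forall x, 0 < x -> f x * g x = 1) -> posdef A -> hfun f A *m hfun g A = 1%:M.
Proof.
move=> fg hA; rewrite hfunM (eq_hfun_posdef fg hA).
by rewrite [LHS]hdiag_cst ?spectral_unitarymx// rmorph1.
Qed.

Lemma hfun_posdef_mul n f g (A : 'M[C]_n) :
  (forall x, 0 < x -> f x * g x = x) -> posdef A -> hfun f A *m hfun g A = A.
Proof.
move=> fg hA; rewrite hfunM (eq_hfun_posdef fg hA).
by rewrite hfun_id//; exact: posdef_herm.
Qed.

Lemma posdef_qf_gt0 n (A : 'M[C]_n) v : posdef A -> qf 1%:M v = 1 -> 0 < qf A v.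
Proof.
move=> [U [l [hU -> l0]]] v1; rewrite qf_hdiag lt_def sumr_ge0 ?andbT; last first.
  by move=> i _; rewrite mulr_ge0 ?sqmod_ge0 ?ltW.
rewrite psumr_neq0; last by move=> i _; rewrite mulr_ge0 ?sqmod_ge0 ?ltW.
apply: contraT => /hasPn h; move: v1; rewrite -(sum_sqmod_coord _ hU) big1.
  by move/eqP; rewrite eq_sym oner_eq0.
move=> i _; have := h i (mem_index_enum _).
rewrite andTb lt_def mulf_eq0 mulr_ge0 ?sqmod_ge0 ?(ltW (l0 i))// andbT negbK.
by rewrite gt_eqF//= => /eqP.
Qed.

Lemma qf_le_tr m n (A B : 'M[C]_n) (T : 'M[C]_(m, n)) :
  (forall v, qf A v <= qf B v) ->
  re (\tr (T *m A *m T^t*)) <= re (\tr (T *m B *m T^t*)).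
Proof. by move=> h; rewrite -!sum_qf_row; apply: ler_sum. Qed.

Lemma re_tr_sqr m n (A : 'M[C]_(m, n)) :
  re (\tr (A *m A^t*)) = \sum_i \sum_j sqmod (A i j).
Proof.
rewrite re_sum; apply: eq_bigr => i _; rewrite mxE re_sum.
by apply: eq_bigr => j _; rewrite !mxE.
Qed.

Lemma re_tr_sqr_ge0 m n (A : 'M[C]_(m, n)) : 0 <= re (\tr (A *m A^t*)).
Proof. by rewrite re_tr_sqr; do 2![apply: sumr_ge0 => ? _]; exact: sqmod_ge0. Qed.

Lemma re_tr_sqr_gt0 m n (A : 'M[C]_(m, n)) : A != 0 -> 0 < re (\tr (A *m A^t*)).
Proof.
move=> A0; rewrite lt_def re_tr_sqr_ge0 andbT; apply: contraNN A0.
rewrite re_tr_sqr => h; apply/eqP/matrixP => i j; rewrite mxE.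
move: h; rewrite psumr_eq0; last by move=> k _; apply: sumr_ge0 => ? _; exact: sqmod_ge0.
move=> /allP/(_ i (mem_index_enum _)) /=.
rewrite psumr_eq0; last by move=> k _; exact: sqmod_ge0.
by move=> /allP/(_ j (mem_index_enum _)) /=; rewrite sqmod_eq0 => /eqP.
Qed.

Lemma herm_eig_le1 N (F : 'M[C]_N) : herm F ->
  (forall (v : 'rV[C]_N) mu, v != 0 -> v *m F = mu%:C *: v -> mu <= 1) ->
  forall v, qf F v <= qf 1%:M v.
Proof.
move=> /herm_hdiag[U [l [hU ->]]] h v.
rewrite -(sum_sqmod_coord _ hU) qf_hdiag; apply: ler_sum => i _.
rewrite -[leRHS]mul1r ler_wpM2r ?sqmod_ge0//; apply: (h (row i U)).
  apply/eqP => r0; have := qf1_row i hU.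
  by rewrite r0 /qf !mul0mx mxE re0 => /eqP; rewrite eq_sym oner_eq0.
rewrite /hdiag -row_mul !mulmxA unitarymxV// mul1mx.
by apply/rowP => j; rewrite mul_diag_mx !mxE.
Qed.

Lemma mxvec_dot m n (A B : 'M[C]_(m, n)) :
  (mxvec A *m (mxvec B)^t*) 0 0 = \tr (A *m B^t*).
Proof.
rewrite [LHS]mxE (reindex _ (curry_mxvec_bij _ _)) /=.
transitivity (\sum_(p : 'I_m * 'I_n) A p.1 p.2 * (B p.1 p.2)^*).
  by apply: eq_bigr => -[i j] _ /=; rewrite 2![in X in _ * X]mxE !mxvecE.
rewrite -(pair_bigA _ (fun i j => A i j * (B i j)^*)) /=.
by apply: eq_bigr => i _; rewrite mxE; apply: eq_bigr => j _; rewrite !mxE.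
Qed.

Lemma mxtraceC n (A : 'M[C]_n) : \tr (A^t*) = (\tr A)^*.
Proof. by rewrite rmorph_sum; apply: eq_bigr => i _; rewrite !mxE. Qed.

(** Self-adjointness for the Hilbert-Schmidt inner product on matrices, for
    which [mxvec] is an isometry, is Hermitian symmetry of the matrix
    [lin_mx f]. *)
Lemma lin_mx_herm m n (f : {linear 'M[C]_(m, n) -> 'M[C]_(m, n)}) :
  (forall K L, \tr (f K *m L^t*) = (\tr (f L *m K^t*))^*) -> herm (lin_mx f).
Proof.
move=> h; apply/matrixP => i j; rewrite [LHS]mxE [X in X^*]mxE.
have e (u v : 'I_(m * n)) : (lin_mx f) u v =
    \tr (f (vec_mx (delta_mx 0 u)) *m (vec_mx (delta_mx 0 v))^t*).
  rewrite -mxvec_dot -mul_vec_lin !vec_mxK -rowE.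
  move: (lin_mx f) => F; rewrite [RHS]mxE (bigD1 v)//= big1 ?addr0 => [|w wv].
    by rewrite !mxE !eqxx/= rmorph1 mulr1.
  by rewrite !mxE (negbTE wv) andbF/= rmorph0 mulr0.
by rewrite !e h conjCK.
Qed.

Section Superop.
Context (n : nat) (J : finType) (X Y : J -> 'M[C]_n).
Definition superop (K : 'M[C]_n) : 'M[C]_n := \sum_j X j *m K *m Y j.
Lemma superop_linear : linear superop.
Proof.
move=> c K L; rewrite /superop scaler_sumr -big_split; apply: eq_bigr => j _ /=.
by rewrite mulmxDr mulmxDl -scalemxAr -scalemxAl.
Qed.
HB.instance Definition _ :=
  GRing.isLinear.Build C 'M[C]_n 'M[C]_n _ superop superop_linear.
End Superop.

(** This is the operator inequality which underlies the joint concavity of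
    (A, B) -> tr (A^(1/2) K B^(1/2) K') (Lieb), or of the geometric mean of the
    commuting superoperators A (x) 1 and 1 (x) B (Ando). Conjugate by the
    square roots of q and r: it must be shown that the self-adjoint
    superoperator f (K) = sum_j s P_j s K t T_j t, with s = q^(-1/2) and
    t = r^(-1/2), has no eigenvalue greater than 1. If f (K) = mu K, then
    M = s K t satisfies sum_j P_j M T_j = mu q M r. Pair this equation with
    L = q^(-1) M r. The left side is at most half of
    sum_j |P_j L|^2 + |M T_j|^2, which is at most |q L|^2 + |M r|^2
    by the two hypotheses, that is 2 |M r|^2; the right side is mu |M r|^2. *)
Lemma superop_le n (J : finType) (P T : J -> 'M[C]_n) (q r : 'M[C]_n) :
  (forall j, herm (P j)) -> (forall j, herm (T j)) -> posdef q -> posdef r ->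
  (forall v, qf (\sum_j P j *m P j) v <= qf (q *m q) v) ->
  (forall v, qf (\sum_j T j *m T j) v <= qf (r *m r) v) ->
  forall K, \sum_j re (\tr (P j *m K *m T j *m K^t*)) <=
            re (\tr (q *m K *m r *m K^t*)).
Proof.
move=> hP hT hq hr Pq Tr2 K0.
pose isq (x : R) := (Num.sqrt x)^-1.
have isq1 (x : R) : 0 < x -> isq x * Num.sqrt x = 1.
  by move=> x0; rewrite mulVf// gt_eqF// sqrtr_gt0.
have isq2 (x : R) : 0 < x -> Num.sqrt x * isq x = 1 by move=> ?; rewrite mulrC isq1.
have sq2 (x : R) : 0 < x -> Num.sqrt x * Num.sqrt x = x.
  by move=> x0; rewrite -expr2 sqr_sqrtr// ltW.
pose s := hfun isq q; pose t := hfun isq r.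
pose s' := hfun Num.sqrt q; pose t' := hfun Num.sqrt r.
have ss' : s *m s' = 1%:M by exact: hfun_posdef_mul1.
have s's : s' *m s = 1%:M by exact: hfun_posdef_mul1.
have tt' : t *m t' = 1%:M by exact: hfun_posdef_mul1.
have t't : t' *m t = 1%:M by exact: hfun_posdef_mul1.
have s's' : s' *m s' = q by exact: (hfun_posdef_mul sq2 hq).
have t't' : t' *m t' = r by exact: (hfun_posdef_mul sq2 hr).
have hs : herm s by exact: hfun_herm.
have ht : herm t by exact: hfun_herm.
have hs' : herm s' by exact: hfun_herm.
have ht' : herm t' by exact: hfun_herm.
have hqh := posdef_herm hq; have hrh := posdef_herm hr.
clearbody s s' t t'.
pose f := superop (fun j => s *m P j *m s) (fun j => t *m T j *m t).
have hF : herm (lin_mx f).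
  apply: lin_mx_herm => K L; rewrite -mxtraceC /f /superop !mulmx_suml trmxC_sum.
  rewrite !(raddf_sum (@mxtrace _ _)) /=; apply: eq_bigr => j _.
  have hX : herm (s *m P j *m s) by rewrite /herm !trmxCM hs hP mulmxA.
  have hY : herm (t *m T j *m t) by rewrite /herm !trmxCM ht hT mulmxA.
  by rewrite trmxCM trmxCK trmxCM hY trmxCM hX -!(mulmxA (s *m P j *m s)) mxtrace_mulC !mulmxA.
have key : forall K, re (\tr (f K *m K^t*)) <= re (\tr (K *m K^t*)).
  move=> K1; have := herm_eig_le1 hF _ (mxvec K1).
  rewrite /qf mulmx1 mul_vec_lin !mxvec_dot; apply.
  move=> v mu; rewrite -[v]vec_mxK; move: (vec_mx v) => {v} K.
  rewrite mul_vec_lin mxvec_eq0 => K0n; rewrite -linearZ => /(can_inj mxvecK) /= fK.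
  have {}fK : f K = mu%:C *: K := fK.
  pose M := s *m K *m t.
  have KM : K = s' *m M *m t'.
    by rewrite /M !mulmxA s's mul1mx -mulmxA tt' mulmx1.
  have eM : \sum_j P j *m M *m T j = mu%:C *: (q *m M *m r).
    transitivity (s' *m f K *m t'); last first.
      by rewrite fK -scalemxAr -scalemxAl {1}KM !mulmxA s's' -(mulmxA _ t' t') t't'.
    rewrite /f /superop mulmx_sumr mulmx_suml; apply: eq_bigr => j _.
    by rewrite /M !mulmxA s's mul1mx -[RHS]mulmxA tt' mulmx1.
  pose qi := s *m s.
  have qqi : q *m qi = 1%:M.
    by rewrite -s's' /qi mulmxA -[X in X *m _]mulmxA s's mulmx1.
  pose N := M *m r; pose L := qi *m N.
  have N0 : N != 0.
    apply: contra_neq K0n => N0; rewrite KM.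
    have -> : s' *m M *m t' = s' *m N *m t.
      by rewrite /N -t't' !mulmxA -(mulmxA _ t' t) t't mulmx1.
    by rewrite N0 mulmx0 mul0mx.
  have qL : q *m L = N by rewrite /L mulmxA qqi mul1mx.
  have eN : N = M *m r by [].
  clearbody L N M; rewrite -(ler_pM2r (re_tr_sqr_gt0 N0)) mul1r.
  have h1 : \sum_j re (\tr (P j *m L *m (P j *m L)^t*)) <= re (\tr (N *m N^t*)).
    have := qf_le_tr (L^t*) Pq; rewrite trmxCK mulmx_sumr mulmx_suml raddf_sum re_sum.
    rewrite [X in _ <= X -> _](_ : _ = re (\tr (N *m N^t*))); last first.
      by rewrite -qL trmxCM hqh [in RHS]mxtrace_mulC !mulmxA.
    apply: le_trans; apply: ler_sum => j _.
    by rewrite mxtrace_mulC trmxCM hP !mulmxA.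
  have h2 : \sum_j re (\tr (M *m T j *m (M *m T j)^t*)) <= re (\tr (N *m N^t*)).
    have := qf_le_tr M Tr2; rewrite mulmx_sumr mulmx_suml raddf_sum re_sum.
    rewrite [X in _ <= X -> _](_ : _ = re (\tr (N *m N^t*))); last first.
      by rewrite eN trmxCM hrh !mulmxA.
    apply: le_trans; apply: ler_sum => j _.
    by rewrite trmxCM hT !mulmxA.
  have h3 : \sum_j re (\tr (P j *m L *m (M *m T j)^t*)) = mu * re (\tr (N *m N^t*)).
    transitivity (re (\tr (L *m (\sum_j P j *m M *m T j)^t*))).
      rewrite trmxC_sum mulmx_sumr raddf_sum re_sum; apply: eq_bigr => j _.
      by rewrite !trmxCM hP hT -mulmxA mxtrace_mulC !mulmxA.
    rewrite eM trmxCZ -scalemxAr mxtraceZ reZ; congr (_ * re _).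
    by rewrite -mulmxA -eN trmxCM hqh mulmxA mxtrace_mulC mulmxA qL.
  (* Expanding the squares |P_j L - M T_j|^2 >= 0 bounds the pairing. *)
  have h4 : 0 <= \sum_j re (\tr ((P j *m L - M *m T j) *m (P j *m L - M *m T j)^t*)).
    by apply: sumr_ge0 => j _; exact: re_tr_sqr_ge0.
  have e4 : \sum_j re (\tr ((P j *m L - M *m T j) *m (P j *m L - M *m T j)^t*)) =
    \sum_j re (\tr (P j *m L *m (P j *m L)^t*)) +
    \sum_j re (\tr (M *m T j *m (M *m T j)^t*)) -
    2 * \sum_j re (\tr (P j *m L *m (M *m T j)^t*)).
    rewrite mulr_sumr -big_split -sumrB; apply: eq_bigr => j _ /=.
    move: (P j *m L) (M *m T j) => A B.
    rewrite linearB map_mxB mulmxBl !mulmxBr !(raddfB (@mxtrace _ _)) /= !reB.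
    have -> : re (\tr (B *m A^t*)) = re (\tr (A *m B^t*)).
      by rewrite -(re_mxtraceC (A *m B^t*)) trmxCM trmxCK.
    by ring.
  by rewrite e4 h3 in h4; lra.
have := key (s' *m K0 *m t').
rewrite [X in _ <= X -> _](_ : _ = re (\tr (q *m K0 *m r *m K0^t*))); last first.
  rewrite !trmxCM hs' ht' -s's' -t't' -[in RHS]mulmxA -[in RHS]mulmxA.
  by rewrite -[in RHS]mulmxA [in RHS]mxtrace_mulC !mulmxA.
apply: le_trans; rewrite /f /superop mulmx_suml raddf_sum re_sum.
rewrite le_eqVlt; apply/orP; left; apply/eqP; apply: eq_bigr => j _.
rewrite !trmxCM hs' ht' !mulmxA.
rewrite -(mulmxA (s *m P j) s s') ss' mulmx1.
rewrite -(mulmxA _ t' t) t't mulmx1 -(mulmxA _ t t') tt' mulmx1.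
by rewrite /= -!mulmxA [in RHS]mxtrace_mulC -!mulmxA s's mulmx1.
Qed.

(** Both sides are biadditive in the summands, so the inequality for each pair
    (i, k) suffices. *)
Lemma superop_sum_le n (I J : finType) (P : I -> J -> 'M[C]_n) (q : I -> 'M[C]_n) :
  (forall i j, herm (P i j)) -> (forall i, posdef (q i)) ->
  (forall i v, qf (\sum_j P i j *m P i j) v <= qf (q i *m q i) v) ->
  forall K, \sum_j re (\tr ((\sum_i P i j) *m K *m (\sum_i P i j) *m K^t*)) <=
    re (\tr ((\sum_i q i) *m K *m (\sum_i q i) *m K^t*)).
Proof.
move=> hP hq Pq K.
have e (X : I -> 'M[C]_n) : re (\tr ((\sum_i X i) *m K *m (\sum_i X i) *m K^t*)) =
    \sum_i \sum_k re (\tr (X i *m K *m X k *m K^t*)).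
  rewrite !mulmx_suml raddf_sum re_sum; apply: eq_bigr => i _ /=.
  by rewrite mulmx_sumr mulmx_suml raddf_sum re_sum.
rewrite e; under eq_bigr do rewrite e.
rewrite exchange_big /=; apply: ler_sum => i _.
rewrite exchange_big /=; apply: ler_sum => k _.
exact: superop_le.
Qed.

(** * From superoperators to traces of powers *)

(** In the eigenbasis of the diagonalized matrix the right side is the sum over
    all (i, k) of l i * l k times the squared modulus of the (i, k) entry
    of K; only the diagonal terms are kept. *)
Lemma sum_diag_sqr_le n (U K : 'M[C]_n) l : U \is unitarymx -> (forall i, 0 <= l i) ->
  \sum_i (l i * qf K (row i U)) ^+ 2 <= re (\tr (hdiag U l *m K *m hdiag U l *m K^t*)).
Proof.
move=> hU l0; pose D : 'M[C]_n := diag_mx (\row_i (l i)%:C).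
pose L := U *m K *m U^t*.
have -> : \tr (hdiag U l *m K *m hdiag U l *m K^t*) = \tr ((D *m L) *m (D *m L^t*)).
  by rewrite /L !trmxCM trmxCK /hdiag -/D -!mulmxA mxtrace_mulC -!mulmxA.
rewrite re_sum; apply: ler_sum => i _; rewrite [in leRHS]mxE re_sum (bigD1 i)//=.
have e k : re ((D *m L) i k * (D *m L^t*) k i) = l i * l k * sqmod (L i k).
  clearbody L; rewrite !mul_diag_mx !mxE mulrACA -sqmodE -!rmorphM.
  by rewrite rcK.
rewrite e; apply: (@le_trans _ _ (l i * l i * sqmod (L i i))).
  by rewrite exprMn -expr2 ler_wpM2l ?sqr_ge0// qf_row; exact: sqr_re.
rewrite lerDl; apply: sumr_ge0 => k _; rewrite e !mulr_ge0//; exact: sqmod_ge0.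
Qed.

(** Take for K the rank one matrix of v: each trace becomes the square of a
    quadratic form. *)
Lemma qf_le_of_superop n (J : finType) (a : J -> 'M[C]_n) (q : 'M[C]_n) :
  (forall j, psd (a j)) -> psd q ->
  (forall K, \sum_j re (\tr (a j *m K *m a j *m K^t*)) <=
             re (\tr (q *m K *m q *m K^t*))) ->
  forall j v, qf (a j) v <= qf q v.
Proof.
move=> ha hq h j v.
have e A : psd A -> re (\tr (A *m (v^t* *m v) *m A *m (v^t* *m v)^t*)) = qf A v ^+ 2.
  move=> [hA _]; rewrite trmxCM trmxCK !mulmxA mxtrace_mulC !mulmxA.
  rewrite -(mulmxA (v *m A *m v^t*)) -(mulmxA (v *m A *m v^t*)).
  have : (v *m A *m v^t*)^t* = v *m A *m v^t* by rewrite !trmxCM trmxCK hA mulmxA.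
  rewrite /qf; move: (v *m A *m v^t*) => z /matrixP/(_ 0 0); rewrite !mxE => hz.
  rewrite /mxtrace big_ord1 !mxE big_ord1 -{1 2}(rc_re S (x := z 0 0)).
    by rewrite -rmorphM rcK expr2.
  by apply/CrealP.
rewrite -ler_sqr ?nnegrE; [|exact: (proj2 (ha j))|exact: (proj2 hq)].
have := h (v^t* *m v); rewrite e//; under eq_bigr do rewrite e//.
by apply: le_trans; rewrite (bigD1 j)//= lerDl; apply: sumr_ge0 => k _; exact: sqr_ge0.
Qed.

Lemma tr_sandwich_trpow n (q : 'M[C]_n) s : posdef q ->
  re (\tr (q *m hfun (fun x => x `^ s) q *m q *m (hfun (fun x => x `^ s) q)^t*)) =
  trpow (2 + 2 * s) q.
Proof.
move=> hq; rewrite (hfun_herm _ q) -{1 3}(hfun_id (posdef_herm hq)) !hfunM.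
congr (re (\tr _)); apply: eq_hfun_posdef => // x x0.
have x0' : x != 0 by rewrite gt_eqF.
rewrite (_ : 2 + 2 * s = 1 + s + 1 + s); last by ring.
by rewrite !powRD ?x0' ?implybT// powRr1 ?ltW.
Qed.

Lemma posdef_unitmx n (A : 'M[C]_n) : posdef A -> A \in unitmx.
Proof.
move=> hA; suff /mulmx1_unit[] : A *m hfun (fun x => x^-1) A = 1%:M by [].
rewrite -{1}(hfun_id (posdef_herm hA)); apply: hfun_posdef_mul1 => // x x0.
by rewrite mulfV// gt_eqF.
Qed.

(** The function x^s is not operator monotone for s > 1, but only the diagonal
    entry at an eigenvector h of a is needed. From a <= q follows h q^(-1)
    h' <= (l i)^(-1), by testing a <= q on h q^(-1); Jensen's inequality
    for the convex function x^(-s) and the matrix q^(-1) then gives the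
    bound for every s >= 0. *)
Lemma powR_le_diag n (a q : 'M[C]_n) U l s : posdef q -> U \is unitarymx ->
  a = hdiag U l -> (forall i, 0 <= l i) -> (forall v, qf a v <= qf q v) -> 0 <= s ->
  forall i, 0 < l i -> l i `^ s <= qf (hfun (fun x => x `^ s) q) (row i U).
Proof.
move=> hq hU aE l0 aq s0 i li.
set h := row i U.
have h1 : qf 1%:M h = 1 by exact: qf1_row.
pose qi := hfun (fun x => x^-1) q.
have hqi : posdef qi by apply: hfun_posdef => // x x0; rewrite invr_gt0.
have qi0 : 0 < qf qi h by exact: posdef_qf_gt0.
have qqi : q *m qi = 1%:M.
  rewrite -{1}(hfun_id (posdef_herm hq)); apply: hfun_posdef_mul1 => // x x0.
  by rewrite mulfV// gt_eqF.
have qiq : qi *m q = 1%:M.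
  rewrite -(hfun_id (posdef_herm hq)); apply: hfun_posdef_mul1 => // x x0.
  by rewrite mulVf// gt_eqF.
have hl : l i * qf qi h <= 1.
  rewrite -(ler_pM2r qi0) mul1r.
  have : qf q (h *m qi) = qf qi h.
    by rewrite qf_congr (posdef_herm hqi) qiq mul1mx.
  move=> {3}<-; apply: le_trans (aq _); rewrite aE qf_hdiag.
  rewrite (bigD1 i)//= -mulrA -expr2 ler_wpDr//.
    by apply: sumr_ge0 => k _; rewrite mulr_ge0 ?sqmod_ge0.
  rewrite ler_pM2l// {1}/h qf_row; apply: le_trans (sqr_re S _) _.
  by rewrite /h -!row_mul [in leRHS]mxE.
have -> : hfun (fun x => x `^ s) q = hfun (fun x => x `^ (- s)) qi.
  rewrite /qi hfun_comp; apply: eq_hfun_posdef => // x x0 /=.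
  by rewrite -(powR_inv1 (ltW x0)) -powRrM mulN1r opprK.
have := @qf_jensen _ qi h (- s) (posdef_psd hqi).
rewrite /convex_exponent oppr_le0 s0 orbT => /(_ _ isT h1) jens.
apply: le_trans (jens _); last first.
  by move=> _; have /mulmx1_unit[] := qiq.
rewrite powRN -[leRHS]mul1r ler_pdivlMr ?powR_gt0// -powRM ?(ltW li) ?(ltW qi0)//.
have -> : (1 : R) = 1 `^ s by rewrite powR1.
rewrite ge0_ler_powR ?nnegrE//.
by rewrite mulr_ge0// ltW.
Qed.

(** Test the hypothesis on K = q^((p - 2) / 2): the right side becomes tr q^p.
    On the left, [sum_diag_sqr_le] in the eigenbasis of each summand and
    [powR_le_diag] leave at least the sum of the l i ^ p. *)
Lemma trpow_superadd n (J : finType) (a : J -> 'M[C]_n) (q : 'M[C]_n) p :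
  2 <= p -> (forall j, psd (a j)) -> posdef q ->
  (forall K, \sum_j re (\tr (a j *m K *m a j *m K^t*)) <=
             re (\tr (q *m K *m q *m K^t*))) ->
  \sum_j trpow p (a j) <= trpow p q.
Proof.
move=> p2 ha hq h; pose s := (p - 2) / 2.
have pE : p = 2 + 2 * s by rewrite /s; field.
have s0 : 0 <= s by rewrite /s divr_ge0 ?subr_ge0.
have := tr_sandwich_trpow s hq; rewrite -pE => <-; apply: le_trans (h _).
apply: ler_sum => j _; have aq := qf_le_of_superop ha (posdef_psd hq) h j.
have [U [l [hU aE l0]]] := psd_hdiag (ha j).
rewrite {1}aE hfunE// tr_hdiag// aE; apply: le_trans (sum_diag_sqr_le _ hU l0).
apply: ler_sum => i _ /=; have [li|li] := ltrP 0 (l i); last first.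
  have -> : l i = 0 by apply/eqP; rewrite eq_le li l0.
  by rewrite powR0 ?sqr_ge0// gt_eqF// (lt_le_trans _ p2).
rewrite {1}pE powRD; last by apply/implyP => _; rewrite gt_eqF.
rewrite powR_mulrn// exprMn ler_wpM2l ?sqr_ge0// mulrC powRrM powR_mulrn ?powR_ge0//.
have lk := powR_le_diag hq hU aE l0 aq s0 li.
by rewrite lerXn2r ?nnegrE ?powR_ge0// (le_trans _ lk) ?powR_ge0.
Qed.

(** The same K = q^((p - 2) / 2) as for p >= 2, now a nonpositive power of q.
    At an eigenvector of a j with eigenvalue l, let k and d be the diagonal
    entries of K and q^p. Jensen's inequality, applied to K as a nonpositive
    power of q^p, gives k >= d^((p - 2) / (2 p)). So
    (N (l k)^2)^(p / 2) d^(1 - p / 2) is at least N^(p / 2) l^p, and the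
    weighted arithmetic-geometric mean inequality separates it into two terms
    whose sums are controlled by tr q^p. *)
Lemma trpow_concave n (J : finType) (a : J -> 'M[C]_n) (q : 'M[C]_n) p :
  0 < p <= 2 -> (forall j, psd (a j)) -> posdef q ->
  (forall K, \sum_j re (\tr (a j *m K *m a j *m K^t*)) <=
             re (\tr (q *m K *m q *m K^t*))) ->
  (#|J|%:R : R) `^ (p / 2) * \sum_j trpow p (a j) <= #|J|%:R * trpow p q.
Proof.
move=> /andP[p0 p2] ha hq h; pose s := (p - 2) / 2; set N : R := #|J|%:R.
have N0 : 0 <= N by rewrite ler0n.
have pE : p = 2 + 2 * s by rewrite /s; field.
pose th := p / 2.
have th01 : 0 < th <= 1 by rewrite /th divr_gt0//= ler_pdivrMr// mul1r.
have hqp : posdef (hfun (fun x => x `^ p) q).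
  by apply: hfun_posdef => // x x0; exact: powR_gt0.
have K0 : posdef (hfun (fun x => x `^ s) q).
  by apply: hfun_posdef => // x x0; exact: powR_gt0.
set K := hfun (fun x => x `^ s) q.
have hK : \sum_j re (\tr (a j *m K *m a j *m K^t*)) <= trpow p q.
  by apply: le_trans (h _) _; have := tr_sandwich_trpow s hq; rewrite -pE => <-.
apply: (@le_trans _ _ (\sum_j (th * N * re (\tr (a j *m K *m a j *m K^t*)) +
   (1 - th) * trpow p q))); last first.
  rewrite big_split /= -mulr_sumr sumr_const -[_ *+ #|J|]mulr_natl -/N.
  have := ler_wpM2l (mulr_ge0 (ltW (proj1 (andP th01))) N0) hK; lra.
rewrite mulr_sumr; apply: ler_sum => j _.
have [U [l [hU aE l0]]] := psd_hdiag (ha j).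
rewrite -(sum_qf_unitary (hfun (fun x => x `^ p) q) hU).
rewrite {1}aE hfunE// tr_hdiag// aE.
apply: (@le_trans _ _ (\sum_i (th * N * (l i * qf K (row i U)) ^+ 2 +
    (1 - th) * qf (hfun (fun x => x `^ p) q) (row i U)))); last first.
  rewrite big_split -!mulr_sumr lerD2r ler_wpM2l//; last exact: sum_diag_sqr_le.
  by rewrite mulr_ge0// ltW//; case/andP: th01.
rewrite mulr_sumr; apply: ler_sum => i _ /=.
set d := qf (hfun _ q) _; set k := qf K _.
have d0 : 0 < d by apply: posdef_qf_gt0 => //; exact: qf1_row.
have k0 : 0 < k by apply: posdef_qf_gt0 => //; exact: qf1_row.
have dk : d `^ (s / p) <= k.
  rewrite /k /K (_ : hfun _ q = hfun (fun x => x `^ (s / p)) (hfun (fun x => x `^ p) q)).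
    apply: qf_jensen; [exact: posdef_psd| | |exact: qf1_row].
      by move=> _; exact: posdef_unitmx.
    by rewrite /convex_exponent ler_pdivrMr// mul0r /s ler_pdivrMr// mul0r subr_le0 p2 orbT.
  rewrite hfun_comp; apply: eq_hfun_posdef => // x x0 /=.
  by rewrite -powRrM mulrC divfK// gt_eqF.
clearbody d k; have [li|li] := ltrP 0 (l i); last first.
  have -> : l i = 0 by apply/eqP; rewrite eq_le li l0.
  rewrite powR0 ?gt_eqF// mulr0 addr_ge0// mulr_ge0 ?(ltW d0) ?sqr_ge0//.
    by rewrite mulr_ge0// ltW//; case/andP: th01.
  by rewrite subr_ge0; case/andP: th01.
rewrite -mulrA; apply: le_trans (powR_amgm _ d0 th01); last first.
  by rewrite mulr_ge0 ?sqr_ge0.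
rewrite powRM ?sqr_ge0// -mulrA ler_wpM2l ?powR_ge0//.
rewrite -powR_mulrn ?(mulr_ge0 (ltW li) (ltW k0))// -powRrM.
have -> : 2%:R * th = p by rewrite /th; field.
rewrite powRM ?(ltW li) ?(ltW k0)// -mulrA ler_pMr ?powR_gt0//.
have d1 : d `^ (s / p * p) * d `^ (1 - th) = 1.
  rewrite -powRD ?(gt_eqF d0) ?implybT// (_ : _ + _ = 0) ?powRr0//.
  by rewrite /th /s; field; rewrite gt_eqF.
rewrite -[leLHS]d1.
apply: ler_wpM2r; first exact: powR_ge0.
rewrite powRrM; apply: ge0_ler_powR => //; first exact: ltW.
  by rewrite nnegrE powR_ge0.
by rewrite nnegrE; exact: ltW.
Qed.

(** * The quadratic symmetric modulus *)

Definition meansqr n (A : 'M[C]_n) : 'M[C]_n :=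
  2^-1 *: (hmod A *m hmod A + hmod (A^t*) *m hmod (A^t*)).
Definition hqsym n (A : 'M[C]_n) := hfun Num.sqrt (meansqr A).

Lemma rc_half : (2^-1)%:C = 2^-1.
Proof. by rewrite fmorphV rmorph_nat. Qed.

Lemma meansqr_psd n (A : 'M[C]_n) : psd (meansqr A).
Proof.
rewrite /meansqr -rc_half; apply: psdZ; first by rewrite invr_ge0.
by rewrite !hmod_sqr; apply: psdD; exact: gram_psd.
Qed.

Lemma hqsym_psd n (A : 'M[C]_n) : psd (hqsym A).
Proof. by apply: hfun_psd => x; exact: sqrtr_ge0. Qed.

Lemma qf_hfun_le n f g (A : 'M[C]_n) v :
  (forall x, 0 <= x -> f x <= g x) -> psd A -> qf (hfun f A) v <= qf (hfun g A) v.
Proof.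
move=> fg /psd_hdiag[U [l [hU -> l0]]]; rewrite !hfunE// !qf_hdiag.
by apply: ler_sum => i _; rewrite ler_wpM2r ?sqmod_ge0// fg.
Qed.

Lemma hfun_affine n (A : 'M[C]_n) c d :
  herm A -> hfun (fun x => c * (x + d)) A = c%:C *: (A + (d%:C)%:M).
Proof.
move=> /herm_hdiag[U [l [hU ->]]].
by rewrite hfunE// -(hdiag_cst d hU) hdiagD hdiagZ.
Qed.

(** The superoperator inequality needs invertible bounds, and Q may be
    singular. For d > 0 the matrix q d is the sum over i of the positive
    definite matrices 2^(1/2) (hqsym (A i) + d / #|I|). The square of each of
    them dominates 2 meansqr (A i), the sum of the squares of the moduli of
    A i and of its adjoint. The final bounds are reached as d tends to 0. *)
Section Bounds.
Context (n : nat) (I : finType) (A : I -> 'M[C]_n) (I0 : (0 < #|I|)%N).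
Let Q := \sum_i hqsym (A i).
Let q d := hfun (fun x => Num.sqrt 2 * (x + d)) Q.
Let a (j : bool) := \sum_i hmod (if j then A i else (A i)^t*).

Let Qpsd : psd Q. Proof. by apply: psd_sum => i; exact: hqsym_psd. Qed.

Let apsd j : psd (a j). Proof. by apply: psd_sum => i; exact: hmod_psd. Qed.

Lemma shifted_posdef d : 0 < d -> posdef (q d).
Proof.
move=> d0; have [U [l [hU QE l0]]] := psd_hdiag Qpsd.
exists U, (fun i => Num.sqrt 2 * (l i + d)); split=> //.
  by rewrite /q QE hfunE.
by move=> i; rewrite mulr_gt0 ?sqrtr_gt0// ltr_wpDl.
Qed.

Lemma moduli_superop_le d : 0 < d -> forall K,
  \sum_j re (\tr (a j *m K *m a j *m K^t*)) <= re (\tr (q d *m K *m q d *m K^t*)).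
Proof.
move=> d0; pose e := d / #|I|%:R.
have I0' : 0 < #|I|%:R :> R by rewrite ltr0n.
have e0 : 0 < e by rewrite /e divr_gt0.
pose g x : R := Num.sqrt 2 * (Num.sqrt x + e).
have g0 x : 0 < g x by rewrite mulr_gt0 ?sqrtr_gt0// ltr_wpDl// sqrtr_ge0.
have qE : q d = \sum_i hfun g (meansqr (A i)).
  rewrite /q hfun_affine; last by case: Qpsd.
  have gE i : hfun g (meansqr (A i)) = (Num.sqrt 2)%:C *: (hqsym (A i) + (e%:C)%:M).
    rewrite -hfun_affine; last by case: (hqsym_psd (A i)).
    by rewrite /hqsym hfun_comp.
  rewrite (eq_bigr _ (fun i _ => gE i)) -scaler_sumr big_split /= sumr_const -/Q.
  congr (_ *: (_ + _)); rewrite -scaler_nat -(rmorph_nat rc) scale_scalar_mx.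
  by rewrite -rmorphM /e mulrC divfK// gt_eqF.
rewrite qE; apply: superop_sum_le => [i j|i|i v].
- by case: (hmod_psd (if j then A i else (A i)^t*)).
- have [U [l [hU ME l0]]] := psd_hdiag (meansqr_psd (A i)).
  by exists U, (g \o l); split=> [//||k]; [rewrite ME hfunE|exact: g0].
rewrite big_bool /= hfunM.
have -> : hmod (A i) *m hmod (A i) + hmod ((A i)^t*) *m hmod ((A i)^t*) =
    hfun (fun x => 2 * x) (meansqr (A i)).
  transitivity ((2%:R)%:C *: meansqr (A i)).
    by rewrite /meansqr rmorph_nat scalerA mulfV ?scale1r// pnatr_eq0.
  have [U [l [hU -> l0]]] := psd_hdiag (meansqr_psd (A i)).
  by rewrite hfunE// hdiagZ.
apply: qf_hfun_le; last exact: meansqr_psd.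
move=> x x0; rewrite /g mulrACA -expr2 sqr_sqrtr// ler_wpM2l//.
rewrite -{1}(sqr_sqrtr x0) expr2 ler_pM ?sqrtr_ge0// lerDl; exact: ltW.
Qed.

Lemma trpow_shifted p : exists l : 'I_n -> R, [/\ forall i, 0 <= l i,
  trpow p Q = \sum_i l i `^ p &
  forall d, trpow p (q d) = \sum_i (Num.sqrt 2 * (l i + d)) `^ p].
Proof.
have [U [l [hU QE l0]]] := psd_hdiag Qpsd; exists l; split=> //.
  by rewrite QE hfunE// tr_hdiag.
by move=> d'; rewrite /q hfun_comp QE hfunE// tr_hdiag.
Qed.

Lemma sqrt2_powR (p : R) : Num.sqrt 2 `^ p = 2 `^ (p / 2) :> R.
Proof. by rewrite -powR12_sqrt// -powRrM mulrC. Qed.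

Lemma trpow_sum_ge2 p : 2 <= p ->
  2 * trpow p (hmod (\sum_i A i)) <= 2 `^ (p / 2) * trpow p Q.
Proof.
move=> p2; have p1 : 1 <= p by apply: le_trans p2; rewrite ler1n.
have [l [l0 QE qE]] := trpow_shifted p.
rewrite QE mulr_sumr.
rewrite (eq_bigr (fun i => (Num.sqrt 2 * l i) `^ p)); last first.
  by move=> i _; rewrite powRM ?sqrtr_ge0// sqrt2_powR.
apply: sum_powR_shift_limit; rewrite ?sqrtr_ge0// => d d0; rewrite -qE.
apply: le_trans (trpow_sum_le_moduli A p1) _.
have := trpow_superadd p2 apsd (shifted_posdef d0) (moduli_superop_le d0).
by rewrite big_bool.
Qed.

Lemma trpow_sum_le2 p : 1 <= p <= 2 ->
  trpow p (hmod (\sum_i A i)) <= trpow p Q.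
Proof.
move=> /andP[p1 p2]; have p0 : 0 < p <= 2 by rewrite (lt_le_trans _ p1).
have [l [l0 QE qE]] := trpow_shifted p.
have c0 : 0 < 2 `^ (p / 2) :> R by rewrite powR_gt0.
rewrite -(ler_pM2l c0) QE mulr_sumr.
rewrite [leRHS](eq_bigr (fun i => (Num.sqrt 2 * l i) `^ p)); last first.
  by move=> i _; rewrite powRM ?sqrtr_ge0// sqrt2_powR.
apply: sum_powR_shift_limit; rewrite ?sqrtr_ge0// => d d0; rewrite -qE.
have := trpow_concave p0 apsd (shifted_posdef d0) (moduli_superop_le d0).
have := ler_wpM2l (ltW c0) (trpow_sum_le_moduli A p1).
rewrite big_bool card_bool /=; lra.
Qed.

Lemma qf_moduli_le j v : qf (a j) v <= Num.sqrt 2 * qf Q v.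
Proof.
apply: (@le_of_linear_perturbation _ _ _ (Num.sqrt 2 * qf 1%:M v)) => d /andP[d0 _].
apply: le_trans (qf_le_of_superop apsd (posdef_psd (shifted_posdef d0)) (moduli_superop_le d0) j v) _.
rewrite /q hfun_affine; last by case: Qpsd.
by rewrite qfZ qfD -scalemx1 qfZ; lra.
Qed.

End Bounds.

(** * Schatten norms *)

Definition hopnorm n (X : 'M[C]_n) : R :=
  \big[Num.max/0]_(i < n) re (spectral_diag (hmod X) 0 i).

Definition hschatten n (p : \bar R) (X : 'M[C]_n) : R :=
  match p with
  | r%:E => trpow r (hmod X) `^ r^-1
  | +oo%E => hopnorm X
  | -oo%E => 0
  end.

Lemma hopnorm_ge0 n (X : 'M[C]_n) : 0 <= hopnorm X.
Proof. exact: bigmax_ge_id. Qed.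

Lemma qf_le_hopnorm n (X : 'M[C]_n) v : qf (hmod X) v <= hopnorm X * qf 1%:M v.
Proof.
rewrite {1}(spectral_hdiag (proj1 (hmod_psd X))).
rewrite -(sum_sqmod_coord _ (spectral_unitarymx (hmod X))) qf_hdiag mulr_sumr.
apply: ler_sum => i _; rewrite ler_wpM2r ?sqmod_ge0//.
rewrite /hopnorm; exact: le_bigmax.
Qed.

Lemma hopnorm_le n (X : 'M[C]_n) c : 0 <= c ->
  (forall v, qf (hmod X) v <= c * qf 1%:M v) -> hopnorm X <= c.
Proof.
move=> c0 h; apply: bigmax_le => // i _.
have := h (row i (spectralmx (hmod X))).
rewrite {1}(spectral_hdiag (proj1 (hmod_psd X))).
by rewrite qf_hdiag_row ?qf1_row ?spectral_unitarymx// mulr1.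
Qed.

Lemma qf_block n (A B : 'M[C]_n) u v :
  qf (block_mx A 0 0 B) (row_mx u v) = qf A u + qf B v.
Proof.
rewrite /qf mul_row_block !mulmx0 addr0 add0r tr_row_mx map_col_mx mul_row_col.
by rewrite mxE reD.
Qed.

Lemma qf_hmod_le n (H : 'M[C]_n) c : herm H ->
  (forall v, `|qf H v| <= c * qf 1%:M v) -> forall v, qf (hmod H) v <= c * qf 1%:M v.
Proof.
move=> hH h v; rewrite hmod_herm//; move: h.
have [U [l [hU ->]]] := herm_hdiag hH => h.
rewrite hfunE// qf_hdiag -(sum_sqmod_coord _ hU) mulr_sumr; apply: ler_sum => i _ /=.
rewrite ler_wpM2r ?sqmod_ge0//; have := h (row i U).
by rewrite qf_hdiag_row// qf1_row// mulr1.
Qed.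

(** For p infinite the bound on the quadratic forms of the two sums of moduli
    suffices: it bounds the Hermitian dilation of the sum by a multiple of
    the identity. *)
Lemma hopnorm_sum n (I : finType) (A : I -> 'M[C]_n) : (0 < #|I|)%N ->
  hopnorm (\sum_i A i) <= Num.sqrt 2 * hopnorm (\sum_i hqsym (A i)).
Proof.
move=> I0; set Q := \sum_i hqsym (A i); set c := _ * _.
have hQ : psd Q by apply: psd_sum => i; exact: hqsym_psd.
have c0 : 0 <= c by rewrite mulr_ge0 ?sqrtr_ge0 ?hopnorm_ge0.
have le_c j v : qf (\sum_i hmod (if j then A i else (A i)^t*)) v <= c * qf 1%:M v.
  apply: le_trans (qf_moduli_le A I0 j v) _; rewrite -mulrA ler_wpM2l ?sqrtr_ge0//.
  by have := qf_le_hopnorm Q v; rewrite (hmod_id hQ).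
apply: hopnorm_le => // v.
have h w : `|qf (dilation (\sum_i A i)) w| <= c * qf 1%:M w.
  apply: le_trans (qf_dilation_sum A w) _.
  rewrite -[w]hsubmxK scalar_mx_block !qf_block mulrDr lerD//.
    exact: (le_c false).
  exact: (le_c true).
have := qf_hmod_le (dilation_herm _) h (row_mx 0 v).
rewrite hmod_dilation scalar_mx_block !qf_block.
have qf00 (M : 'M[C]_n) : qf M 0 = 0 by rewrite /qf !mul0mx mxE re0.
by rewrite !qf00 !add0r.
Qed.

Lemma trpow_ge0 n (A : 'M[C]_n) p : 0 <= trpow p A.
Proof.
rewrite /hfun tr_hdiag ?spectral_unitarymx//.
by apply: sumr_ge0 => i _; exact: powR_ge0.
Qed.

Lemma hmod_sum_hqsym n (I : finType) (A : I -> 'M[C]_n) :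
  hmod (\sum_i hqsym (A i)) = \sum_i hqsym (A i).
Proof. by apply: hmod_id; apply: psd_sum => i; exact: hqsym_psd. Qed.

Lemma hschatten_sum_le2 n (I : finType) (A : I -> 'M[C]_n) p : (0 < #|I|)%N ->
  (1%:E <= p)%E -> (p <= 2%:E)%E ->
  hschatten p (\sum_i A i) <= hschatten p (\sum_i hqsym (A i)).
Proof.
move=> I0; case: p => [p| |]; rewrite ?leye_eq ?leeNy_eq // !lee_fin => p1 p2 /=.
rewrite hmod_sum_hqsym; apply: ge0_ler_powR; rewrite ?nnegrE ?trpow_ge0//.
  by rewrite invr_ge0 (le_trans _ p1).
by apply: trpow_sum_le2 => //; rewrite p1.
Qed.

(** The power of 2 is split as 2^(p/2) = 2 * 2^(p/2 - 1) to cancel the factor 2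
    that counts the two blocks of the dilation. *)
Lemma hschatten_sum_ge2 n (I : finType) (A : I -> 'M[C]_n) p : (0 < #|I|)%N ->
  (2%:E <= p)%E ->
  hschatten p (\sum_i A i) <=
    2 `^ (2^-1 - fine (p^-1)%E) * hschatten p (\sum_i hqsym (A i)).
Proof.
move=> I0; case: p => [p| |]; rewrite ?leeNy_eq // ?lee_fin => p2 /=; last first.
  by rewrite subr0 powR12_sqrt//; exact: hopnorm_sum.
have p0 : 0 < p by apply: lt_le_trans p2.
rewrite inver (gt_eqF p0) /= hmod_sum_hqsym.
have -> : 2 `^ (2^-1 - p^-1) = (2 `^ (p / 2 - 1)) `^ p^-1 :> R.
  rewrite -powRrM; congr powR; field; rewrite gt_eqF//.
rewrite -powRM ?powR_ge0 ?trpow_ge0//.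
apply: ge0_ler_powR; rewrite ?nnegrE ?mulr_ge0 ?powR_ge0 ?trpow_ge0//.
  by rewrite invr_ge0 ltW.
have := trpow_sum_ge2 A I0 p2.
have -> : (2 : R) `^ (p / 2) = 2 * 2 `^ (p / 2 - 1).
  by rewrite mulr_powRB1// divr_gt0.
by rewrite -mulrA ler_pM2l.
Qed.

(** * Sharpness *)

Lemma unitary1 n : (1%:M : 'M[C]_n) \is unitarymx.
Proof. by apply/unitarymxP; rewrite trmxC1 mulmx1. Qed.

Lemma hdiag_1mx n l : hdiag (1%:M : 'M[C]_n) l = diag_mx (\row_i (l i)%:C).
Proof. by rewrite /hdiag trmxC1 mul1mx mulmx1. Qed.

Lemma meansqrE n (A : 'M[C]_n) : meansqr A = 2^-1 *: (A^t* *m A + A *m A^t*).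
Proof. by rewrite /meansqr !hmod_sqr trmxCK. Qed.

Lemma hqsym0 n : hqsym (0 : 'M[C]_n) = 0.
Proof.
rewrite /hqsym meansqrE mulmx0 mul0mx addr0 scaler0.
have e : (0 : 'M[C]_n) = hdiag 1%:M (fun=> 0).
  by rewrite hdiag_cst ?unitary1// rmorph0 raddf0.
rewrite [in LHS]e hfunE ?unitary1// [RHS]e; apply: eq_hdiag => i /=; exact: sqrtr0.
Qed.

Lemma hqsym1 n : hqsym (1%:M : 'M[C]_n) = 1%:M.
Proof.
rewrite /hqsym meansqrE trmxC1 mulmx1.
have e : (1%:M : 'M[C]_n) = hdiag 1%:M (fun=> 1).
  by rewrite hdiag_cst ?unitary1// rmorph1.
rewrite -mulr2n -scaler_nat scalerA mulVf ?pnatr_eq0// scale1r.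
rewrite [in LHS]e hfunE ?unitary1// [RHS]e; apply: eq_hdiag => i /=; exact: sqrtr1.
Qed.

Lemma psd1 n : psd (1%:M : 'M[C]_n).
Proof.
rewrite -(rmorph1 rc) -(hdiag_cst 1 (unitary1 n)).
by apply: hdiag_psd => i; exact: ler01.
Qed.

Lemma hschatten1_gt0 n (p : R) : (0 < n)%N -> 0 < hschatten p%:E (1%:M : 'M[C]_n).
Proof.
move=> n0; rewrite /= (hmod_id (psd1 n)) powR_gt0//.
have -> : (1%:M : 'M[C]_n) = hdiag 1%:M (fun=> 1).
  by rewrite hdiag_cst ?unitary1// rmorph1.
rewrite hfunE ?unitary1// tr_hdiag ?unitary1//=.
under eq_bigr do rewrite powR1.
by rewrite sumr_const card_ord ltr0n.
Qed.

(** The extremal matrix for p >= 2 is a matrix unit off the diagonal. Its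
    singular value 1 is simple, whereas its quadratic symmetric modulus is
    2^(-1/2) times a projection of rank 2. *)
Section Unit.
Context (n : nat) (i0 i1 : 'I_n) (i01 : i0 != i1).
Let E : 'M[C]_n := delta_mx i0 i1.

Let EtE : E^t* *m E = hdiag 1%:M (fun i => (i == i1)%:R).
Proof.
rewrite /E trmx_delta map_delta_mx mul_delta_mx hdiag_1mx.
apply/matrixP => i j; rewrite !mxE rmorph_nat.
have [->|_] := eqVneq i i1; last by rewrite mul0rn.
by rewrite [i1 == j]eq_sym /=; case: (j == i1).
Qed.

Let EEt : E *m E^t* = hdiag 1%:M (fun i => (i == i0)%:R).
Proof.
rewrite /E trmx_delta map_delta_mx mul_delta_mx hdiag_1mx.
apply/matrixP => i j; rewrite !mxE rmorph_nat.
have [->|_] := eqVneq i i0; last by rewrite mul0rn.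
by rewrite [i0 == j]eq_sym /=; case: (j == i0).
Qed.

Lemma hmod_delta : hmod E = hdiag 1%:M (fun i => (i == i1)%:R).
Proof.
rewrite /hmod EtE hfunE ?unitary1//; apply: eq_hdiag => i /=.
by case: eqP; rewrite ?sqrtr1 ?sqrtr0.
Qed.

Lemma hqsym_delta :
  hqsym E = hdiag 1%:M (fun i => (Num.sqrt 2)^-1 * ((i == i0) || (i == i1))%:R).
Proof.
rewrite /hqsym meansqrE EtE EEt hdiagD -(rc_half) hdiagZ hfunE ?unitary1//.
apply: eq_hdiag => i /=; rewrite sqrtrM ?invr_ge0// sqrtrV//; congr (_ * _).
have [->|_] := eqVneq i i0; first by rewrite (negbTE i01) add0r sqrtr1.
by rewrite addr0 /=; case: eqP; rewrite ?sqrtr1 ?sqrtr0.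
Qed.

Lemma hschatten_delta (r : R) : 0 < r -> hschatten r%:E E = 1.
Proof.
move=> r0; rewrite /= hmod_delta hfunE ?unitary1// tr_hdiag ?unitary1//=.
rewrite (bigD1 i1)//= eqxx powR1 big1 ?addr0 ?powR1// => i /negbTE ->.
by rewrite powR0// gt_eqF.
Qed.

Lemma hschatten_qsym_delta (r : R) : 0 < r ->
  hschatten r%:E (hqsym E) = 2 `^ (r^-1 - 2^-1).
Proof.
move=> r0; rewrite /= (hmod_id (hqsym_psd E)) hqsym_delta.
rewrite hfunE ?unitary1// tr_hdiag ?unitary1//=.
rewrite (bigD1 i0)//= (bigD1 i1) 1?eq_sym//= !eqxx orbT !mulr1 big1 ?addr0; last first.
  by move=> i /andP[/negbTE -> /negbTE ->]; rewrite mulr0 powR0// gt_eqF.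
have -> : (Num.sqrt 2)^-1 = 2 `^ (- 2^-1) :> R by rewrite powRN powR12_sqrt.
rewrite -powRrM; set x := 2 `^ _.
have -> : x + x = 2 `^ (1 + - 2^-1 * r).
  rewrite powRD; last by rewrite pnatr_eq0 implybT.
  by rewrite powRr1// -/x; ring.
rewrite -powRrM; congr powR; field; by rewrite gt_eqF.
Qed.

Lemma hopnorm_delta_ge1 : 1 <= hopnorm E.
Proof.
have := qf_le_hopnorm E (row i1 1%:M).
by rewrite hmod_delta qf_hdiag_row ?unitary1// qf1_row ?unitary1// eqxx mulr1.
Qed.

Lemma hopnorm_qsym_delta : hopnorm (hqsym E) <= (Num.sqrt 2)^-1.
Proof.
apply: hopnorm_le => [|v]; first by rewrite invr_ge0 sqrtr_ge0.
rewrite (hmod_id (hqsym_psd E)) hqsym_delta qf_hdiag.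
rewrite -(sum_sqmod_coord v (unitary1 n)) mulr_sumr; apply: ler_sum => i _.
rewrite ler_wpM2r ?sqmod_ge0// ler_piMr ?invr_ge0 ?sqrtr_ge0//.
by case: (_ || _).
Qed.

End Unit.

Lemma sum_single n (I : finType) (k0 : I) (X : 'M[C]_n) (F : 'M[C]_n -> 'M[C]_n) :
  F 0 = 0 -> \sum_k F (if k == k0 then X else 0) = F X.
Proof.
move=> F0; rewrite (bigD1 k0)//= eqxx big1 ?addr0// => k /negbTE ->; exact: F0.
Qed.

(** A family with a single nonzero member reduces the question to one matrix:
    the identity gives the constant 1, and an off-diagonal matrix unit
    gives 2^(1/2 - 1/p). *)
Lemma sharp_constants n (I : finType) (p : \bar R) (c : R) :
  (0 < #|I|)%N -> (2 <= n)%N -> (1%:E <= p)%E ->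
  (forall A : I -> 'M[C]_n,
     hschatten p (\sum_k A k) <= c * hschatten p (\sum_k hqsym (A k))) ->
  ((p <= 2%:E)%E -> 1 <= c) /\
  ((2%:E <= p)%E -> 2 `^ (2^-1 - fine (p^-1)%E) <= c).
Proof.
move=> /card_gt0P[k0 _] n2 p1 h.
have {}h (X : 'M[C]_n) : hschatten p X <= c * hschatten p (hqsym X).
  have := h (fun k => if k == k0 then X else 0).
  by rewrite (@sum_single _ _ k0 X id)// (sum_single k0 X (@hqsym0 n)).
split.
  case: p p1 h => [p| |]; rewrite ?leye_eq ?leeNy_eq // !lee_fin => p1 h p2.
  have := h 1%:M; rewrite hqsym1 -{1}[hschatten _ _]mul1r ler_pM2r//.
  by apply: hschatten1_gt0; exact: leq_trans n2.
pose i0 : 'I_n := Ordinal (leq_trans (isT : 0 < 2)%N n2).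
pose i1 : 'I_n := Ordinal (leq_trans (isT : 1 < 2)%N n2).
have i01 : i0 != i1 by [].
have := h (delta_mx i0 i1).
case: p p1 h => [p| |]; rewrite ?leeNy_eq // ?lee_fin => p1 _.
  have p0 : 0 < p by apply: lt_le_trans p1.
  rewrite hschatten_delta// hschatten_qsym_delta// => hc _.
  rewrite inver (gt_eqF p0) /= -[X in _ `^ X]opprB powRN.
  by rewrite -[leLHS]mul1r ler_pdivrMr ?powR_gt0.
move=> /= hc _; rewrite subr0 powR12_sqrt//.
have h1 := le_trans (hopnorm_delta_ge1 i0 i1) hc.
have c0 : 0 <= c.
  rewrite leNgt; apply/negP => c0; have := lt_le_trans ltr01 h1; rewrite ltNge.
  by rewrite nmulr_rle0// hopnorm_ge0.
have := le_trans h1 (ler_wpM2l c0 (hopnorm_qsym_delta i01)).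
by rewrite ler_pdivlMr ?sqrtr_gt0// mul1r.
Qed.

End ComplexMatrices.

(** * The case of R[i] *)

Lemma Re_sqr_le (R : realType) (x : R[i]) :
  complex.Re x ^+ 2 <= complex.Re (x * x^*).
Proof. by case: x => a b /=; rewrite mulrN opprK -!expr2 lerDl sqr_ge0. Qed.

Lemma Re_ge0 (R : realType) (x : R[i]) : 0 <= x -> 0 <= complex.Re x.
Proof. by case: x => a b; rewrite lecE => /andP[]. Qed.

Definition complexRealPart (R : realType) : realPart R (R[i] : numClosedFieldType).
Proof.
refine (@RealPart R R[i] (real_complex R) (@complex.Re R) _ _ _ _ _ _ _ _).
- by move=> [a b] [c d].
- by move=> k [a b] /=; rewrite mul0r subr0.
- by [].
- by move=> [a b].
- by move=> k; exact: conjc_real.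
- by move=> x; exact: RRe_real.
- exact: Re_ge0.
- exact: Re_sqr_le.
Defined.

Section Transfer.
Local Open Scope sesquilinear_scope.
Context (R : realType) (n : nat).
Let S := complexRealPart R.

Lemma hermfun_hfun f (A : 'M[R[i]]_n) : hermfun f A = hfun S f A.
Proof.
rewrite /hermfun /hfun /hdiag; have := invmx_unitary (spectral_unitarymx A).
move=> ->; congr mulmx; congr mulmx; congr diag_mx.
by apply/rowP => i; rewrite !mxE.
Qed.

Lemma mxmod_hmod (A : 'M[R[i]]_n) : mxmod A = hmod S A.
Proof. exact: hermfun_hfun. Qed.

Lemma qsymmod_hqsym (A : 'M[R[i]]_n) : qsymmod A = hqsym S A.
Proof. by rewrite /qsymmod /mxsqrt hermfun_hfun !mxmod_hmod. Qed.

Lemma schatten_hschatten p (A : 'M[R[i]]_n) : schatten p A = hschatten S p A.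
Proof.
case: p => [r| |]; last by [].
- apply: (congr1 (fun M => complex.Re (\tr M) `^ r^-1)).
  exact: (etrans (hermfun_hfun _ _) (congr1 (hfun S _) (mxmod_hmod A))).
apply: (congr1 (fun M : 'M_n =>
  \big[Num.max/0]_(i < n) complex.Re (spectral_diag M 0 i))).
exact: mxmod_hmod.
Qed.

Lemma sum_qsymmod_hqsym (I : finType) (A : I -> 'M[R[i]]_n) :
  \sum_k qsymmod (A k) = \sum_k hqsym S (A k).
Proof. by apply: eq_bigr => k _; exact: qsymmod_hqsym. Qed.

Lemma schatten_sum_qsymmod (I : finType) p (A : I -> 'M[R[i]]_n) :
  schatten p (\sum_k qsymmod (A k)) = hschatten S p (\sum_k hqsym S (A k)).
Proof.
exact: (etrans (congr1 (schatten p) (sum_qsymmod_hqsym A)) (schatten_hschatten _ _)).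
Qed.

End Transfer.

Theorem theorem1p16 (R : realType) (m n : nat) (p : \bar R)
    (hm : (2 <= m)%N) (hn : (2 <= n)%N) (hp : (1%:E <= p)%E) :
  [/\ (p <= 2%:E)%E -> forall A : 'I_m -> 'M[R[i]]_n,
        schatten p (\sum_(k < m) A k)
          <= schatten p (\sum_(k < m) qsymmod (A k)),
      (2%:E <= p)%E -> forall A : 'I_m -> 'M[R[i]]_n,
        schatten p (\sum_(k < m) A k)
          <= 2 `^ (2^-1 - fine (p^-1)%E)
             * schatten p (\sum_(k < m) qsymmod (A k))
    & forall c : R,
        (forall A : 'I_m -> 'M[R[i]]_n,
           schatten p (\sum_(k < m) A k)
             <= c * schatten p (\sum_(k < m) qsymmod (A k))) ->
        ((p <= 2%:E)%E -> 1 <= c) /\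
        ((2%:E <= p)%E -> 2 `^ (2^-1 - fine (p^-1)%E) <= c)].
Proof.
have I0 : (0 < #|'I_m|)%N by rewrite card_ord (leq_trans _ hm).
split=> [p2 A|p2 A|c h].
- have e1 := schatten_hschatten p (\sum_k A k).
  have e2 := schatten_sum_qsymmod p A.
  exact: (etrans (congr2 (fun x y : R => x <= y) e1 e2)
                 (hschatten_sum_le2 (complexRealPart R) A I0 hp p2)).
- have e1 := schatten_hschatten p (\sum_k A k).
  have e2 := schatten_sum_qsymmod p A.
  exact: (etrans (congr2 (fun x y : R => x <= _ * y) e1 e2)
                 (hschatten_sum_ge2 (complexRealPart R) A I0 p2)).
apply: (sharp_constants (S := complexRealPart R) I0 hn hp) => A.
have e1 := schatten_hschatten p (\sum_k A k).
have e2 := schatten_sum_qsymmod p A.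
exact: (etrans (esym (congr2 (fun x y : R => x <= c * y) e1 e2)) (h A)).
Qed.
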